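(* Let $m$ agents indexed by $i=1,\ldots,m$ each observe, at each time step $j=1,2,\ldots$, a pair $(x_{i,j},y_{i,j})$ generated by $y_{i,j}=\Theta x_{i,j}+\eta_{i,j}$, where $\Theta\in\mathbb{R}^{l\times n}$ is unknown, and $x_{i,j}\sim\mathcal{N}(\mu_{i,j},\sigma_x^2I_n)$, $\eta_{i,j}\sim\mathcal{N}(0,\sigma_\eta^2I_l)$ are Gaussian random vectors, all mutually independent over time and agents, with deterministic means satisfying $\sup_{i,j}\|\mu_{i,j}\|=\hat{\mu}<\infty$ (here $\sigma_x>0$, $\sigma_\eta>0$). Let the global least-squares estimate be $\hat{\Theta}_{t+1}=\big(\sum_{i=1}^m\sum_{j=1}^t y_{i,j}x_{i,j}^*\big)\big(\sum_{i=1}^m\sum_{j=1}^tx_{i,j}x_{i,j}^*\big)^{-1}$. Fix $\delta>0$ and let $t\ge\frac{1}{m}\max(t_1,t_2,t_3)$, where $t_1=8n+16\log\frac{2}{\delta}$, $t_2=\left(\frac{16\hat{\mu}(\sqrt{4n}+\sqrt{2\log\frac{2}{\delta}})}{\sigma_x}\right)^2$, $t_3=2(n+l)\log\frac{1}{\delta}$. Let $\bar{\mu}_t=\frac{4}{mt\sigma_x^2}\sum_{i=1}^m\sum_{j=1}^t\mu_{i,j}\mu_{i,j}^*$. Then with probability at least $1-4\delta$, $$\|\hat{\Theta}_{t+1}-\Theta\|\le\frac{C_1}{\sqrt{mt}\,\sigma_x^2\,\lambda_{\min}(I_n+\bar{\mu}_t)},$$ where $C_1=8\sigma_\eta\left(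4\sigma_x\sqrt{(n+l)\log\frac{9}{\delta}}+\hat{\mu}\big(\sqrt{2(l+n)}+2\sqrt{\log\frac{2}{\delta}}\big)\right)$.
   Context: $\|\cdot\|$ denotes the spectral norm, $A^*$ the (conjugate) transpose, and $\lambda_{\min}$ the smallest eigenvalue (in magnitude). *)

(* Defs.v *)
From HB Require Import structures.
From mathcomp Require Import all_boot all_order all_algebra.
From mathcomp Require Import finmap.
From mathcomp Require Import all_classical all_reals all_analysis.
Set Implicit Arguments. Unset Strict Implicit. Unset Printing Implicit Defensive.
Import Order.TTheory GRing.Theory Num.Theory.
Import numFieldNormedType.Exports.
Local Open Scope classical_set_scope.
Local Open Scope ring_scope.

Definition enorm {R : realType} {n : nat} (v : 'cV[R]_n) : R :=
  Num.sqrt (\sum_(k < n) v k 0 ^+ 2).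

Definition opnorm {R : realType} {p q : nat} (A : 'M[R]_(p, q)) : R :=
  sup [set enorm (A *m v) | v in [set v : 'cV[R]_q | enorm v <= 1]].

(* Smallest eigenvalue (all eigenvalues of the symmetric matrices considered
   here are real). *)
Definition lambda_min {R : realType} {n : nat} (A : 'M[R]_n) : R :=
  inf [set a : R | eigenvalue A a].

Definition mutually_independent {d} {T : measurableType d} {R : realType}
  (P : probability T R) {I : choiceType} (X : I -> {RV P >-> R}) : Prop :=
  forall (J : {fset I}) (B : I -> set R), (forall i, measurable (B i)) ->
    P (\bigcap_(i in [set` J]) (X i @^-1` B i)) =
    \big[*%E/1%E]_(i <- J) P (X i @^-1` B i).

(* The random variable Z is N(mean, s^2)-distributed. *)
Definition is_normal {d} {T : measurableType d} {R : realType}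
  (P : probability T R) (Z : {RV P >-> R}) (mean s : R) : Prop :=
  forall A : set R, measurable A -> distribution P Z A = normal_prob mean s A.
Arguments mutually_independent {d T R} P {I} X.

(* Main.v *)
(** Let [N = m t], [V = sum x x^T], and let [P] be an orthonormal frame of the row
    space of the design.  The estimation error [(sum eta x^T) V^-1] has norm at
    most [||eta P|| / sqrt (lambda_min V)].  With high probability
    - [V >= N sx^2 / 128 + sum mu mu^T]: the exponential moments of
      [|X^T u|^2 - |M^T u|^2] are explicit, and the condition [t >= t2 / m] makes
      the cross terms between the means and the noise negligible;
    - [||eta P|| <= 2 se sqrt (2 (n + l) + 4 ln (2 / delta))]: conditionally on
      the design, [u^T eta P v] is a centered Gaussian.
    Both are Chernoff bounds at the points of a scaled integer lattice, extended
    to the whole sphere by rounding each coordinate to a neighbouring lattice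
    point: for a quadratic function this can be done at a cost controlled by its
    diagonal coefficients alone, which replaces epsilon-nets and Gaussian
    comparison inequalities.  Conditioning is done one Gaussian coordinate at a
    time, integrating it against the sigma-algebra of the other ones. *)
Require Import Defs.
From HB Require Import structures.
From mathcomp Require Import all_boot all_order all_algebra.
From mathcomp Require Import finmap.
From mathcomp Require Import all_classical all_reals all_analysis.
From mathcomp Require Import measurable_realfun.
From mathcomp Require Import ring lra zify.
Import Order.TTheory GRing.Theory Num.Theory.
Import numFieldNormedType.Exports.
Local Open Scope classical_set_scope.
Local Open Scope ring_scope.

Set Implicit Arguments.
Unset Strict Implicit.
Unset Printing Implicit Defensive.

(** * Independence and Gaussian exponential moments *)

(** The target divides by [lambda_min (1 + mubar)] itself, but only the inverse square root of the
    smallest eigenvalue of [V] is ever used; the other half of the decay is paid for by [muhat] in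
    the numerator, through [lambda_min (1 + mubar) - 1 <= 4 muhat^2 / sx^2]. For this the lower
    bound on [V] has to keep the whole of [sum mu mu^T] next to the Gaussian part, which is why the
    energy is studied after subtracting that of the means. The frame turns the noise, of size
    growing with [N], into an [l] by [n] matrix, so that lattice points are counted in dimension
    [n + l] only. It is a measurable function of the design, hence can be frozen while the noise is
    integrated. Rounding sees a quadratic function through its diagonal coefficients: for the design
    these are the energies at the basis vectors, so upper tails are proved there; for the noise the
    form is bilinear and contributes nothing on the diagonal. With [ell = ln (2 / delta)] the design
    fails with probability at most [2 exp (-ell)] and the noise with [exp (-ell)], in total
    [3 delta / 2]. *)

Section independence.
Context d (T : measurableType d) (R : realType) (P : probability T R).
Context (I : choiceType) (Z : I -> {RV P >-> R}).

(** A pi-system generating the sigma-algebra of the coordinates in [J]. [sigma_of J] equips a copy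
    of [T] with it, so that depending only on these coordinates is plain [measurable_fun]. *)
Definition cylinders (J : set I) : set_system T :=
  [set A | exists (F : {fset I}) (B : I -> set R),
    [/\ [set` F] `<=` J, forall i, measurable (B i)
      & A = \bigcap_(i in [set` F]) Z i @^-1` B i]].

Local Notation sigma_of J := (g_sigma_algebraType (cylinders J)).

Lemma cylinders_measurable J : cylinders J `<=` @measurable _ T.
Proof.
move=> _ [F [B [_ mB ->]]]; apply: fin_bigcap_measurable => //.
by move=> i _; rewrite -[X in measurable X]setTI; exact: measurable_funPT.
Qed.

Lemma sigma_of_measurable J (A : set (sigma_of J)) :
  measurable A -> @measurable _ T A.
Proof.
have : <<s cylinders J >> `<=` @measurable _ T; last by apply.
apply: smallest_sub; first exact: sigma_algebra_measurable.
exact: cylinders_measurable.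
Qed.

Lemma sigma_of_sub J K (A : set T) : J `<=` K ->
  @measurable _ (sigma_of J) A -> @measurable _ (sigma_of K) A.
Proof.
move=> JK; have : <<s cylinders J >> `<=` <<s cylinders K >>; last by apply.
apply: sub_sigma_algebra2 => _ [F [B [FJ mB ->]]].
by exists F, B; split => // i /FJ /JK.
Qed.

Lemma measurable_sigma_of_sub d' (U : measurableType d') J K (f : T -> U) :
  J `<=` K -> @measurable_fun _ _ (sigma_of J) U setT f ->
  @measurable_fun _ _ (sigma_of K) U setT f.
Proof. by move=> JK mf _ B mB; apply: (sigma_of_sub JK); apply: mf. Qed.

Lemma measurable_sigma_of d' (U : measurableType d') J (f : T -> U) :
  @measurable_fun _ _ (sigma_of J) U setT f -> measurable_fun setT f.
Proof.
by move=> mf _ B mB; apply: (@sigma_of_measurable J); apply: mf.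
Qed.

Lemma measurable_sigma_of_coord (J : set I) i : J i ->
  @measurable_fun _ _ (sigma_of J) R setT (Z i).
Proof.
move=> Ji _ B mB; rewrite setTI; apply: sub_sigma_algebra.
exists [fset i]%fset, (fun=> B); split => //.
  by move=> k /=; rewrite inE => /eqP ->.
apply/seteqP; split=> [w Bw k /=|w]; first by rewrite inE => /eqP ->.
by apply; rewrite /= inE.
Qed.

Hypothesis indep : mutually_independent P Z.

Lemma cylinders_setI J : setI_closed (cylinders J).
Proof.
move=> _ _ [F [B [FJ mB ->]]] [G [C [GJ mC ->]]].
exists (F `|` G)%fset,
  (fun i => (if i \in F then B i else setT) `&` (if i \in G then C i else setT)).
split.
- by move=> i /=; rewrite inE => /orP[/FJ|/GJ].
- by move=> i; apply: measurableI; case: ifP.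
- apply/seteqP; split=> [w [Bw Cw] i /= _|w BCw].
    by split; case: ifPn => //; [move=> /Bw|move=> /Cw].
  by split=> i /= iF; have := BCw i; rewrite /= inE iF ?orbT => /(_ isT)[].
Qed.

Lemma indep_cylinder J i (A : set R) (B : set T) : ~ J i -> measurable A ->
  cylinders J B -> P (Z i @^-1` A `&` B) = (P (Z i @^-1` A) * P B)%E.
Proof.
move=> Ji mA [F [C [FJ mC ->]]].
have iF : i \notin F by apply/negP => /FJ.
have mAC k : measurable (if k == i then A else C k) by case: ifP.
have := indep (i |` F)%fset mAC.
rewrite big_fsetU1//= eqxx (indep F mC).
have -> : (\big[*%E/1]_(k <- F) P (Z k @^-1` (if k == i then A else C k))
   = \big[*%E/1]_(k <- F) P (Z k @^-1` C k))%E.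
  apply: eq_big_seq => k kF; case: eqP => // ki.
  by move: iF; rewrite -ki kF.
move=> <-; congr (P _); apply/seteqP; split=> [w [Aw Cw] k /=|w ACw].
  rewrite !inE => /orP[/eqP->|kF]; first by rewrite eqxx.
  case: eqP => [ki|_]; last exact: Cw.
  by move: iF; rewrite -ki kF.
split=> [|k /= kF]; first by have := ACw i; rewrite /= !inE eqxx; apply.
have := ACw k; rewrite /= !inE kF orbT => /(_ isT); case: eqP => // ki.
by move: iF; rewrite -ki kF.
Qed.

(** Both sides are finite measures in [B], the restriction of [P] to the event on [Z i] and a
    multiple of [P]. They agree on the pi-system of cylinders, hence on what it generates. *)
Lemma indep_sigma_of J i (A : set R) (B : set T) : ~ J i -> measurable A ->
  @measurable _ (sigma_of J) B ->
  P (Z i @^-1` A `&` B) = (P (Z i @^-1` A) * P B)%E.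
Proof.
move=> Ji mA mB.
have mZA : measurable (Z i @^-1` A).
  by rewrite -[X in measurable X]setTI; exact: measurable_funPT.
pose m1 := mrestr P mZA.
have PA0 : (0 <= fine (P (Z i @^-1` A)))%R by exact: fine_ge0.
pose m2 := mscale (NngNum PA0) P.
have PAE : P (Z i @^-1` A) = (fine (P (Z i @^-1` A)))%:E.
  by rewrite fineK// fin_num_measure.
have E C : cylinders J C -> m1 C = m2 C.
  move=> JC; rewrite /m1 /m2 /mrestr /mscale/= setIC (indep_cylinder Ji)//.
  by rewrite [in LHS]PAE.
rewrite PAE setIC.
apply: (@g_sigma_algebra_measure_unique_trace _ R T (cylinders J) setT
  measurableT _ _ m1 m2) => //.
- by move=> C [/cylinders_measurable].
- move=> B1 B2 [? _] [? _]; split=> //; exact: cylinders_setI.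
- change (P (setT `&` Z i @^-1` A) = ((fine (P (Z i @^-1` A)))%:E * P setT)%E).
  by rewrite setTI probability_setT mule1.
- by move=> C [/E].
- change (P (setT `&` Z i @^-1` A) < +oo)%E.
  by rewrite setTI PAE ltry.
- have -> : [set X | cylinders J X /\ X `<=` setT] = cylinders J => //.
  by apply/seteqP; split=> [X []|X].
Qed.



Lemma integral_indep J i (F : R * sigma_of J -> \bar R) : ~ J i ->
  measurable_fun setT F -> (forall z, 0 <= F z)%E ->
  (\int[P]_w F (Z i w, w) = \int[P]_w \int[distribution P (Z i)]_y F (y, w))%E.
Proof.
move=> Ji mF F0.
have mid : @measurable_fun _ _ T (sigma_of J) setT id.
  by move=> _ B mB; rewrite setTI; exact: (@sigma_of_measurable J).
have mphi : @measurable_fun _ _ T (R * sigma_of J)%type setT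
    (fun w => (Z i w, w)).
  exact: measurable_fun_pair.
(* The identity into [sigma_of J] serves as a random variable carrying all coordinates in [J];
   independence then says that its joint law with [Z i] is a product, and Tonelli applies. *)
pose idJ : {mfun T >-> sigma_of J} :=
  HB.pack (id : T -> sigma_of J) (isMeasurableFun.Build _ _ _ _ _ mid).
pose phi : {mfun T >-> (R * sigma_of J)%type} :=
  HB.pack (fun w => (Z i w, w) : R * sigma_of J)
    (isMeasurableFun.Build _ _ _ _ _ mphi).
pose m1 := distribution P (Z i); pose m2 := distribution P idJ.
have E A : measurable A -> (m1 \x m2)%E A = distribution P phi A.
  move=> mA; apply: (@product_measure_unique _ _ _ _ _ m1 m2) => // {mA}A B mA mB.
  exact: (indep_sigma_of Ji mA mB).
transitivity (\int[m1 \x m2]_z F z)%E.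
  rewrite (@eq_measure_integral _ _ _ _ (distribution P phi)); last first.
    by move=> A mA _; exact: E.
  by rewrite ge0_integral_distribution.
rewrite fubini_tonelli2// /fubini_G.
rewrite ge0_integral_distribution//.
  exact: measurable_fun_fubini_tonelli_G.
by move=> y; exact: integral_ge0.
Qed.

End independence.

(** * Gaussian integrals in one variable *)

Section gaussian_integral.
Variable R : realType.
Notation mu := (@lebesgue_measure R).

(** Change of variables produces the abstract Radon-Nikodym derivative; it agrees almost everywhere
    with the density because both have the same integral over every measurable set. *)
Lemma integral_normal_prob (m s : R) (f : R -> \bar R) :
  measurable_fun setT f -> (forall x, 0 <= f x)%E ->
  (\int[normal_prob m s]_x f x = \int[mu]_x (f x * (normal_pdf m s x)%:E))%E.
Proof.
move=> mf f0; have dom := normal_prob_dominates m s.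
rewrite -(@Radon_Nikodym_SigmaFinite.change_of_variables _ _ _
  (normal_prob m s) mu dom f setT)//.
set g := Radon_Nikodym_SigmaFinite.f _ _.
have ig : mu.-integrable setT g by exact: Radon_Nikodym_SigmaFinite.f_integrable.
have mpdf : measurable_fun setT (fun x => (normal_pdf m s x)%:E).
  by apply/measurable_EFinP; exact: measurable_normal_pdf.
apply: ge0_ae_eq_integral => //.
- by apply: emeasurable_funM => //; exact: (measurable_int mu ig).
- exact: emeasurable_funM.
- by move=> x _; rewrite mule_ge0//; exact: Radon_Nikodym_SigmaFinite.f_ge0.
- by move=> x _; rewrite mule_ge0// lee_fin normal_pdf_ge0.
apply: ae_eqe_mul2l.
apply: integral_ae_eq => // A _ mA.
by rewrite -Radon_Nikodym_SigmaFinite.f_integral.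
Qed.

(** Completing the square: the tilted density is a multiple of the normal density of mean [m'] and
    precision [k / s^2]. A negative [a] is allowed, as upper tails require it. *)
Lemma integral_normal_expR (m s a b : R) : s != 0 -> 0 < 1 + 2 * a * s ^+ 2 ->
  (\int[normal_prob m s]_y (expR (b * y - a * y ^+ 2))%:E =
   (expR ((b * m - a * m ^+ 2 + b ^+ 2 * s ^+ 2 / 2) / (1 + 2 * a * s ^+ 2))
     / Num.sqrt (1 + 2 * a * s ^+ 2))%:E)%E.
Proof.
move=> s0; set k := 1 + _ => k0.
rewrite integral_normal_prob; last 2 first.
- apply/measurable_EFinP/measurableT_comp => //.
  apply: measurable_funB; first exact: mulrl_measurable.
  by apply: measurable_funM => //; exact: exprn_measurable.
- by move=> x; rewrite lee_fin expR_ge0.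
set c := expR _.
have sk0 : Num.sqrt k != 0 by rewrite gt_eqF// sqrtr_gt0.
pose m' := (m + b * s ^+ 2) / k; pose s' := s / Num.sqrt k.
have s'0 : s' != 0 by rewrite mulf_neq0// invr_eq0.
have E y : expR (b * y - a * y ^+ 2) * normal_pdf m s y =
    c / Num.sqrt k * normal_pdf m' s' y.
  rewrite !normal_pdfE// /normal_pdf /normal_peak /normal_fun.
  have -> : s' ^+ 2 = s ^+ 2 / k by rewrite expr_div_n sqr_sqrtr// ltW.
  have -> : Num.sqrt (s ^+ 2 / k * pi *+ 2) =
      Num.sqrt (s ^+ 2 * pi *+ 2) / Num.sqrt k.
    rewrite (mulrAC _ k^-1) -(mulrnAl (s ^+ 2 * pi)) [LHS]sqrtrM ?sqrtrV ?(ltW k0)//.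
    by rewrite mulrn_wge0// mulr_ge0 ?sqr_ge0 ?pi_ge0.
  rewrite invfM invrK.
  set A := Num.sqrt (_ ^+ 2 * pi *+ 2).
  transitivity (A^-1 * (c * expR (- (y - m') ^+ 2 / (s ^+ 2 / k *+ 2)))).
    rewrite mulrCA /c -!expRD; congr (_ * expR _).
    have k0' : k != 0 by rewrite gt_eqF.
    have -> : a = (k - 1) / (2 * s ^+ 2) by rewrite /k; field.
    rewrite /m'; move: k0'; clear -s0; move: k => k k0.
    by field; rewrite s0 k0.
  by rewrite -!mulrA mulrCA; congr (_ * _); rewrite (mulrCA (Num.sqrt k)^-1) mulKf.
under eq_integral do rewrite -EFinM E EFinM.
rewrite ge0_integralZl//; last 3 first.
- by apply/measurable_EFinP; exact: measurable_normal_pdf.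
- by move=> x _; rewrite lee_fin normal_pdf_ge0.
- by rewrite lee_fin divr_ge0// ?expR_ge0 ?sqrtr_ge0.
by rewrite integral_normal_pdf mule1.
Qed.
End gaussian_integral.

Lemma measurable_sum_in d (T : measurableType d) (R : realType) (A : eqType)
    (r : seq A) (c : A -> T -> R) :
  (forall i, i \in r -> measurable_fun setT (c i)) ->
  measurable_fun setT (fun w => \sum_(i <- r) c i w).
Proof.
elim: r => [|i r IH] mc.
  by under eq_fun do rewrite big_nil; exact: measurable_cst.
under eq_fun do rewrite big_cons.
apply: measurable_funD; first by apply: mc; rewrite mem_head.
by apply: IH => j jr; apply: mc; rewrite in_cons jr orbT.
Qed.

(* [R] and the domain [measurableTypeR R] of [normal_prob] carry the same
   sigma-algebra under two different displays, hence the transfer along the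
   identity. *)
Lemma integral_distribution_normal d (T : measurableType d) (R : realType)
    (P : probability T R) (X : {RV P >-> R}) (m s : R) (f : R -> \bar R) :
  is_normal X m s -> measurable_fun setT f -> (forall y, 0 <= f y)%E ->
  (\int[distribution P X]_y f y = \int[normal_prob m s]_y f y)%E.
Proof.
move=> nX mf f0.
have mid : @measurable_fun _ _ (measurableTypeR R) R setT id by [].
pose idR : {mfun measurableTypeR R >-> R} :=
  HB.pack (id : measurableTypeR R -> R) (isMeasurableFun.Build _ _ _ _ _ mid).
transitivity (\int[distribution (normal_prob m s) idR]_y f y)%E.
  by apply: eq_measure_integral => A mA _; exact: nX.
by rewrite ge0_integral_distribution.
Qed.

(** * Exponential moments of independent Gaussian families *)

Section gaussian_family.
Context d (T : measurableType d) (R : realType) (P : probability T R).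
Context (I : choiceType) (Z : I -> {RV P >-> R}) (mn : I -> R) (s : R).
Hypothesis indep : mutually_independent P Z.
Hypothesis s0 : s != 0.
Local Notation sigma_of J := (g_sigma_algebraType (cylinders Z J)).

(** The coefficient [b] and the weight [H] may be random, as long as they ignore coordinate [i].
    This serves both the inductions below and the noise with its random design. *)
Lemma expectation_peel (J : set I) i (m a : R) (b H : T -> R) :
  ~ J i -> is_normal (Z i) m s ->
  @measurable_fun _ _ (sigma_of J) R setT b ->
  @measurable_fun _ _ (sigma_of J) R setT H -> (forall w, 0 <= H w) ->
  0 < 1 + 2 * a * s ^+ 2 ->
  (\int[P]_w (H w * expR (b w * Z i w - a * Z i w ^+ 2))%:E =
   \int[P]_w (H w *
     (expR ((b w * m - a * m ^+ 2 + b w ^+ 2 * s ^+ 2 / 2)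
        / (1 + 2 * a * s ^+ 2)) / Num.sqrt (1 + 2 * a * s ^+ 2)))%:E)%E.
Proof.
move=> Ji Zi mb mH H0 k0.
pose F (z : R * sigma_of J) : \bar R :=
  (H z.2 * expR (b z.2 * z.1 - a * z.1 ^+ 2))%:E.
have mF : measurable_fun setT F.
  apply/measurable_EFinP/measurable_funM.
    exact: (measurableT_comp mH measurable_snd).
  apply: measurableT_comp => //; apply: measurable_funB.
    apply: measurable_funM; last exact: measurable_fst.
    exact: (measurableT_comp mb measurable_snd).
  apply: measurable_funM => //.
  by apply: measurable_funX; exact: measurable_fst.
have F0 z : (0 <= F z)%E by rewrite lee_fin mulr_ge0 ?expR_ge0.
rewrite (integral_indep indep Ji mF F0); apply: eq_integral => w _.
have mexp : measurable_fun setT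
    (fun y : R => (expR (b w * y - a * y ^+ 2))%:E).
  apply/measurable_EFinP/measurableT_comp => //; apply: measurable_funB.
    exact: mulrl_measurable.
  by apply: measurable_funM => //; exact: exprn_measurable.
have exp0 (y : R) : (0 <= (expR (b w * y - a * y ^+ 2))%:E)%E.
  by rewrite lee_fin expR_ge0.
rewrite /F/=; under eq_integral do rewrite EFinM.
rewrite ge0_integralZl ?lee_fin//.
rewrite (integral_distribution_normal Zi)//.
by rewrite integral_normal_expR// -EFinM.
Qed.

(** Integrating out one coordinate gives again the exponential of a square: [a] becomes [a / k1] and
    the mean joins the offset [b]. The normalizations telescope, as [k1 * (k / k1) = k]. *)
Lemma expectation_sqr_seq (r : seq I) (u : I -> R) (J : set I) (a : R)
    (b H : T -> R) :
  uniq r -> (forall i, i \in r -> ~ J i) ->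
  (forall i, i \in r -> is_normal (Z i) (mn i) s) ->
  @measurable_fun _ _ (sigma_of J) R setT b ->
  @measurable_fun _ _ (sigma_of J) R setT H -> (forall w, 0 <= H w) ->
  let k := 1 + 2 * a * s ^+ 2 * \sum_(i <- r) u i ^+ 2 in 0 < k ->
  (\int[P]_w (H w * expR (- a * (b w + \sum_(i <- r) u i * Z i w) ^+ 2))%:E =
   \int[P]_w (H w * (expR (- a * (b w + \sum_(i <- r) u i * mn i) ^+ 2 / k)
      / Num.sqrt k))%:E)%E.
Proof.
elim: r a b H => [|i r IH] a b H /=.
  move=> _ _ _ _ _ _ _; apply: eq_integral => w _.
  by rewrite !big_nil mulr0 !addr0 sqrtr1 !divr1.
move=> /andP[ir ur] rJ rZ mb mH H0; rewrite !big_cons => k0.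
set k := 1 + _ in k0 *.
set S := \sum_(j <- r) u j ^+ 2 in k k0 *.
have S0 : 0 <= S by apply: sumr_ge0 => j _; exact: sqr_ge0.
have kE : k = 1 + 2 * a * s ^+ 2 * (u i ^+ 2 + S) by [].
pose k1 := 1 + 2 * (a * u i ^+ 2) * s ^+ 2.
(* For [a < 0] the remaining coordinates only lower [k], so [k1 >= k > 0]. *)
have k10 : 0 < k1.
  have [a0|a0] := leP 0 a.
    by rewrite /k1 ltr_wpDr// !(sqr_ge0, mulr_ge0).
  have : 0 <= (- a) * s ^+ 2 * S by rewrite !(sqr_ge0, mulr_ge0)// oppr_ge0 ltW.
  by move: k0; rewrite kE /k1; lra.
pose K : set I := J `|` [set` r].
have JK : J `<=` K by move=> j; left.
have mc : @measurable_fun _ _ (sigma_of K) R setT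
    (fun w => b w + \sum_(j <- r) u j * Z j w).
  apply: measurable_funD; first exact: (measurable_sigma_of_sub JK mb).
  apply: (@measurable_sum_in _ (sigma_of K)) => j jr.
  apply: measurable_funM => //; apply: measurable_sigma_of_coord.
  by right.
under eq_integral => w _.
  rewrite (_ : _ * _ = (H w * expR (- a * (b w + \sum_(j <- r) u j * Z j w) ^+ 2))
     * expR ((- 2 * a * u i * (b w + \sum_(j <- r) u j * Z j w)) * Z i w
          - (a * u i ^+ 2) * Z i w ^+ 2)); last first.
    by rewrite -mulrA -expRD big_cons; congr (_ * expR _); ring.
  over.
rewrite (@expectation_peel K i (mn i))//; last 5 first.
- move=> [/(rJ i (mem_head _ _))//|/= ]; exact/negP.
- by apply: rZ; exact: mem_head.
- by apply: measurable_funM.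
- apply: measurable_funM; first exact: (measurable_sigma_of_sub JK mH).
  apply: measurableT_comp => //; apply: measurable_funM => //.
  exact: measurable_funX.
- by move=> w; rewrite mulr_ge0 ?expR_ge0.
under eq_integral => w _.
  rewrite (_ : _ * _ = (H w / Num.sqrt k1) *
     expR (- (a / k1) * ((b w + u i * mn i) + \sum_(j <- r) u j * Z j w) ^+ 2)).
    over.
  rewrite -/k1 [in RHS]mulrAC -!mulrA; congr (_ * _).
  rewrite mulrA -expRD; congr (expR _ / _).
  have : k1 != 0 by rewrite gt_eqF.
  set c := \sum_(j <- r) _.
  by rewrite /k1 => k10'; field.
have k1k : 1 + 2 * (a / k1) * s ^+ 2 * S = k / k1.
  have : k1 != 0 by rewrite gt_eqF.
  by rewrite kE /k1 => k10'; field.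
rewrite (IH (a / k1) (fun w => b w + u i * mn i) (fun w => H w / Num.sqrt k1))//.
- rewrite -/S k1k; apply: eq_integral => w _; congr EFin.
  rewrite -(mulrA (H w)); congr (_ * _).
  rewrite sqrtrM ?(ltW k0)// sqrtrV ?(ltW k10)// !invf_div.
  rewrite mulrCA mulKf ?gt_eqF ?sqrtr_gt0//.
  rewrite addrA; congr (expR _ / _).
  by field; rewrite !gt_eqF.
- by move=> j jr; apply: rJ; rewrite in_cons jr orbT.
- by move=> j jr; apply: rZ; rewrite in_cons jr orbT.
- exact: measurable_funD.
- exact: measurable_funM.
- by move=> w; rewrite divr_ge0// sqrtr_ge0.
- by rewrite -/S k1k divr_gt0.
Qed.

(** The factor left by each integrated coordinate depends on [J] only, so it can be absorbed into
    [H] before the next one. *)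
Lemma expectation_linear_seq (r : seq I) (J : set I) (b : I -> T -> R) (H : T -> R) :
  uniq r -> (forall i, i \in r -> ~ J i) ->
  (forall i, i \in r -> is_normal (Z i) 0 s) ->
  (forall i, i \in r -> @measurable_fun _ _ (sigma_of J) R setT (b i)) ->
  @measurable_fun _ _ (sigma_of J) R setT H -> (forall w, 0 <= H w) ->
  (\int[P]_w (H w * expR (\sum_(i <- r) b i w * Z i w))%:E =
   \int[P]_w (H w * expR (s ^+ 2 / 2 * \sum_(i <- r) b i w ^+ 2))%:E)%E.
Proof.
elim: r H => [|i r IH] H /=.
  move=> _ _ _ _ _ _; apply: eq_integral => w _.
  by rewrite !big_nil mulr0 expR0.
move=> /andP[ir ur] rJ rZ mb mH H0.
have rJ' j : j \in r -> ~ J j by move=> jr; apply: rJ; rewrite in_cons jr orbT.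
have rZ' j : j \in r -> is_normal (Z j) 0 s.
  by move=> jr; apply: rZ; rewrite in_cons jr orbT.
have mb' j : j \in r -> @measurable_fun _ _ (sigma_of J) R setT (b j).
  by move=> jr; apply: mb; rewrite in_cons jr orbT.
have mbi : @measurable_fun _ _ (sigma_of J) R setT (b i).
  by apply: mb; rewrite mem_head.
pose K : set I := J `|` [set` r].
have JK : J `<=` K by move=> j; left.
under eq_integral => w _.
  rewrite (_ : _ * _ = (H w * expR (\sum_(j <- r) b j w * Z j w)) *
      expR (b i w * Z i w - 0 * Z i w ^+ 2)); last first.
    by rewrite -mulrA -expRD big_cons mul0r subr0 addrC.
  over.
rewrite (@expectation_peel K i 0)//; last 6 first.
- by move=> [/(rJ i (mem_head _ _))//|/= ]; exact/negP.
- by apply: rZ; exact: mem_head.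
- exact: (measurable_sigma_of_sub JK mbi).
- apply: measurable_funM; first exact: (measurable_sigma_of_sub JK mH).
  apply: measurableT_comp => //.
  apply: (@measurable_sum_in _ (sigma_of K)) => j jr.
  apply: measurable_funM; first exact: (measurable_sigma_of_sub JK (mb' j jr)).
  by apply: measurable_sigma_of_coord; right.
- by move=> w; rewrite mulr_ge0 ?expR_ge0.
- by rewrite mulr0 mul0r addr0.
under eq_integral => w _.
  rewrite (_ : _ * _ = (H w * expR (s ^+ 2 / 2 * b i w ^+ 2)) *
      expR (\sum_(j <- r) b j w * Z j w)); last first.
    rewrite !(mulr0, mul0r) subr0 add0r !addr0 sqrtr1 !divr1 mulrAC.
    by congr (_ * expR _ * _); ring.
  over.
have mH' : @measurable_fun _ _ (sigma_of J) R setT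
    (fun w => H w * expR (s ^+ 2 / 2 * b i w ^+ 2)).
  apply: measurable_funM => //; apply: measurableT_comp => //.
  by apply: measurable_funM => //; exact: measurable_funX.
have H0' w : 0 <= H w * expR (s ^+ 2 / 2 * b i w ^+ 2).
  by rewrite mulr_ge0 ?expR_ge0.
rewrite (IH _ ur rJ' rZ' mb' mH' H0').
by apply: eq_integral => w _; congr EFin; rewrite big_cons mulrDr expRD mulrA.
Qed.

Lemma expectation_sqr_prod (G : eqType) (K : finType) (idx : G -> K -> I)
    (u : K -> R) (a : R) (gs : seq G) :
  (forall g k g' k', idx g k = idx g' k' -> g = g' /\ k = k') ->
  (forall g k, is_normal (Z (idx g k)) (mn (idx g k)) s) ->
  let k := 1 + 2 * a * s ^+ 2 * \sum_i u i ^+ 2 in 0 < k -> uniq gs ->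
  (\int[P]_w (expR (- a * \sum_(g <- gs) (\sum_i u i * Z (idx g i) w) ^+ 2))%:E =
   (expR (- a * (\sum_(g <- gs) (\sum_i u i * mn (idx g i)) ^+ 2) / k)
     / Num.sqrt k ^+ size gs)%:E)%E.
Proof.
move=> idx_inj nZ k k0; elim: gs => [|g gs IH] /=.
  move=> _; under eq_integral do rewrite big_nil mulr0 expR0.
  by rewrite big_nil mulr0 mul0r expR0 divr1 integral_cst//= probability_setT mule1.
move=> /andP[ggs ugs].
pose J : set I := [set c | exists2 g', g' \in gs & exists i, c = idx g' i].
pose r := [seq idx g i | i <- enum K].
have idxK i : idx g i \in r by apply: map_f; rewrite mem_enum.
(* Transports [u] to coefficients on [I]; by injectivity of [idx] at most one term survives. *)
pose ur c := \sum_i (if idx g i == c then u i else 0).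
have urE i : ur (idx g i) = u i.
  rewrite /ur (bigD1 i)//= eqxx big1 ?addr0// => j ji; case: eqP => //.
  by move=> /idx_inj[_ /eqP]; rewrite (negbTE ji).
have sum_r (f : I -> R) : \sum_(c <- r) f c = \sum_i f (idx g i).
  by rewrite big_map big_enum.
have sumE (f : I -> R) : \sum_(c <- r) ur c * f c = \sum_i u i * f (idx g i).
  by rewrite sum_r; under eq_bigr do rewrite urE.
pose H w := expR (- a * \sum_(g <- gs) (\sum_i u i * Z (idx g i) w) ^+ 2).
under eq_integral => w _.
  rewrite (_ : expR _ = H w *
      expR (- a * (0 + \sum_(c <- r) ur c * Z c w) ^+ 2)); last first.
    by rewrite /H -expRD big_cons mulrDr addrC sumE add0r.
  over.
have kE : 1 + 2 * a * s ^+ 2 * \sum_(c <- r) ur c ^+ 2 = k.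
  by rewrite sum_r /k; under eq_bigr do rewrite urE.
rewrite (@expectation_sqr_seq r ur J a (fun=> 0) H)//; last 6 first.
- rewrite map_inj_uniq ?enum_uniq// => i j.
  by move=> /idx_inj[].
- move=> c /mapP[i _ ->] [g' g'gs [j /idx_inj[gg' _]]].
  by move: ggs; rewrite gg' g'gs.
- by move=> c /mapP[i _ ->].
- apply: measurableT_comp => //; apply: measurable_funM => //.
  apply: (@measurable_sum_in _ (sigma_of J)) => g' g'gs.
  apply: measurable_funX; apply: (@measurable_sum_in _ (sigma_of J)) => i _.
  apply: measurable_funM => //; apply: measurable_sigma_of_coord.
  by exists g' => //; exists i.
- by move=> w; exact: expR_ge0.
- by rewrite kE.
rewrite kE add0r.
under eq_integral do rewrite mulrC EFinM.
rewrite ge0_integralZl//; last 2 first.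
- apply/measurable_EFinP; apply: measurableT_comp => //.
  apply: measurable_funM => //; apply: measurable_sum_in => g' _.
  apply: measurable_funX; apply: measurable_sum_in => i _.
  exact: measurable_funM.
- by move=> w _; rewrite lee_fin expR_ge0.
rewrite IH// -EFinM; congr EFin.
rewrite mulrACA -expRD -invfM -exprS big_cons; congr (expR _ / _).
rewrite sumE.
by rewrite -mulrDl -mulrDr.
Qed.

End gaussian_family.

(** * Rounding to a lattice *)

Section rounding.
Context (R : realType) (I : finType).
Implicit Types (v : I -> R) (phi : (I -> R) -> R).

Definition shift_at v (i : I) (e : R) : I -> R :=
  fun j => if j == i then v j + e else v j.

(** The leading coefficient is bounded from above only, since rounding has to control increases of
    [phi] alone. *)
Definition coord_quadratic phi (A : R) := forall v i, exists b a,
  a <= A /\ forall e, phi (shift_at v i e) = phi v + b * e + a * e ^+ 2.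

(** With weights [1 - f] and [f], the two neighbours of [v i] have mean [v i]: the linear term
    cancels and the quadratic one contributes [a h^2 f (1 - f)]. One neighbour does no worse than
    the average. *)
Lemma round_coord phi (A h : R) v i : 0 <= A -> 0 < h ->
  coord_quadratic phi A ->
  exists z : int, `|h * z%:~R - v i| <= h /\
    phi (shift_at v i (h * z%:~R - v i)) <= phi v + A * h ^+ 2 / 4.
Proof.
move=> A0 h0 /(_ v i)[b [a [aA phiE]]].
pose z := Num.floor (v i / h); pose f := v i / h - z%:~R.
have f0 : 0 <= f by rewrite subr_ge0 ge_floor.
have f1 : f < 1 by have := lt_succ_floor (v i / h); rewrite -/z intrD; rewrite /f; lra.
have vE : v i = h * (z%:~R + f) by rewrite /f addrC subrK mulrC mulfVK ?gt_eqF.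
have e0 : h * z%:~R - v i = - h * f by rewrite vE; ring.
have e1 : h * (z + 1)%:~R - v i = h * (1 - f) by rewrite vE intrD; ring.
have ff : f * (1 - f) <= 4^-1 by have := sqr_ge0 (f - 2^-1); lra.
have ff0 : 0 <= f * (1 - f) by rewrite mulr_ge0// subr_ge0 ltW.
have ah : a * h ^+ 2 * (f * (1 - f)) <= A * h ^+ 2 / 4.
  have h2 := sqr_ge0 h.
  have H1 : 0 <= (A - a) * (h ^+ 2 * (f * (1 - f))).
    by rewrite mulr_ge0 ?subr_ge0// mulr_ge0.
  have H2 : 0 <= A * h ^+ 2 * (4^-1 - f * (1 - f)).
    by rewrite mulr_ge0 ?subr_ge0// mulr_ge0.
  by move: H1 H2; lra.
have key : (1 - f) * phi (shift_at v i (- h * f))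
    + f * phi (shift_at v i (h * (1 - f))) <= phi v + A * h ^+ 2 / 4.
  rewrite !phiE; apply: le_trans (_ : _ <= phi v + a * h ^+ 2 * (f * (1 - f))) _.
    by rewrite le_eqVlt; apply/orP; left; apply/eqP; ring.
  by rewrite lerD2l.
have [le0|gt0] := leP (phi (shift_at v i (- h * f))) (phi v + A * h ^+ 2 / 4).
  exists z; rewrite e0; split => //.
  by rewrite mulNr normrN ger0_norm ?mulr_ge0 ?(ltW h0)// ler_piMr ?(ltW h0) ?(ltW f1).
exists (z + 1); rewrite e1; split.
  by rewrite ger0_norm ?mulr_ge0 ?subr_ge0 ?(ltW h0) ?(ltW f1)// ler_piMr ?(ltW h0)// gerBl.
rewrite leNgt; apply/negP => gt1.
have : 0 < (1 - f) * (phi (shift_at v i (- h * f)) - (phi v + A * h ^+ 2 / 4)).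
  by rewrite mulr_gt0 ?subr_gt0.
have : 0 <= f * (phi (shift_at v i (h * (1 - f))) - (phi v + A * h ^+ 2 / 4)).
  by rewrite mulr_ge0// subr_ge0 ltW.
by move: key; lra.
Qed.

(* Derandomized rounding: rounding each coordinate of [v] independently to one
   of the two adjacent points of [h Z], with mean [v i], increases the mean of
   [phi] by at most [A h^2 / 4] per coordinate. *)
Lemma round_lattice phi (A h : R) v : 0 <= A -> 0 < h ->
  coord_quadratic phi A ->
  exists z : I -> int, (forall i, `|h * (z i)%:~R - v i| <= h) /\
    phi (fun i => h * (z i)%:~R) <= phi v + #|I|%:R * (A * h ^+ 2 / 4).
Proof.
move=> A0 h0 qphi.
suff H (r : seq I) : uniq r -> exists z : I -> int,
    (forall i, i \in r -> `|h * (z i)%:~R - v i| <= h) /\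
    phi (fun i => if i \in r then h * (z i)%:~R else v i)
      <= phi v + (size r)%:R * (A * h ^+ 2 / 4).
  have [z [zv zphi]] := H (enum I) (enum_uniq I).
  exists z; split; first by move=> i; apply: zv; rewrite mem_enum.
  rewrite cardE; apply: le_trans zphi; rewrite le_eqVlt; apply/orP; left.
  by apply/eqP; congr phi; apply/funext => i; rewrite mem_enum.
elim: r => [_|i r IH /= /andP[ir /IH[z [zv zphi]]]].
  exists (fun=> 0); split=> //; rewrite mul0r addr0 le_eqVlt; apply/orP; left.
  by apply/eqP; congr phi; apply/funext => i; rewrite in_nil.
pose v' i := if i \in r then h * (z i)%:~R else v i.
have [zi [ziv ziphi]] := round_coord v' i A0 h0 qphi.
have v'i : v' i = v i by rewrite /v' (negbTE ir).
exists (fun j => if j == i then zi else z j); split.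
  move=> j; rewrite in_cons; have [->|ji /=] := eqVneq j i; last exact: zv.
  by rewrite -v'i.
apply: (@le_trans _ _ (phi v' + A * h ^+ 2 / 4)).
  apply: le_trans ziphi; rewrite le_eqVlt; apply/orP; left; apply/eqP.
  congr phi; apply/funext => j; rewrite /shift_at in_cons.
  have [->|ji] := eqVneq j i; first by rewrite /= v'i subrKC.
  by rewrite /v'.
by rewrite -(natr1 (size r)) mulrDl mul1r addrA lerD2r.
Qed.

(* AM-GM: [|v i| / h <= c / 2 + (v i)^2 / (2 c h^2)] *)
Lemma round_lattice_size (h rho : R) (c : nat) v (z : I -> int) :
  0 < h -> (0 < c)%N -> rho = c%:R ^+ 2 * #|I|%:R * h ^+ 2 ->
  \sum_i v i ^+ 2 <= rho -> (forall i, `|h * (z i)%:~R - v i| <= h) ->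
  (\sum_i `|z i| <= c.+1 * #|I|)%N.
Proof.
move=> h0 c0 rhoE vrho zv; have cR : (0 : R) < c%:R by rewrite ltr0n.
have H i : (`|z i|%N%:R : R) <= 1 + (c%:R / 2 + v i ^+ 2 / (2 * c%:R * h ^+ 2)).
  rewrite natr_absz -[(`|z i|)%:~R]/(`|z i|%:~R : R) intr_norm.
  have hz : h * `|(z i)%:~R| <= h + `|v i|.
    rewrite -{1}(ger0_norm (ltW h0)) -normrM.
    have := ler_normD (h * (z i)%:~R - v i) (v i); rewrite subrK => /le_trans.
    by apply; rewrite lerD2r.
  have : 0 <= (c%:R * h - `|v i|) ^+ 2 by exact: sqr_ge0.
  rewrite sqrrB real_normK ?num_real// => amgm.
  rewrite -(ler_pM2l h0); apply: (le_trans hz).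
  rewrite mulrDr mulr1 lerD2l -(ler_pM2r (_ : 0 < 2 * c%:R * h)) ?mulr_gt0//.
  rewrite (_ : _ * _ * (2 * c%:R * h) = (c%:R * h) ^+ 2 + v i ^+ 2); last first.
    by field; rewrite !gt_eqF.
  by move: amgm; rewrite -mulr_natr; lra.
rewrite -(ler_nat R) natr_sum; apply: (le_trans (ler_sum _ (fun i _ => H i))).
rewrite big_split/= sumr_const big_split/= sumr_const -mulr_suml.
have : (\sum_i v i ^+ 2) / (2 * c%:R * h ^+ 2) <= c%:R / 2 * #|I|%:R.
  rewrite ler_pdivrMr ?mulr_gt0// ?exprn_gt0//; apply: (le_trans vrho).
  by rewrite rhoE le_eqVlt; apply/orP; left; apply/eqP; field.
rewrite natrM -(natr1 c) -[(_ / 2) *+ _]mulr_natr.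
by lra.
Qed.

End rounding.

(** * Counting lattice points *)

Section lattice_points.
Context (R : realType) (I : finType) (B : nat).

(** Integer points with coordinates from [-B] to [B], stored shifted by [B], so that union bounds
    range over a finite type. *)
Definition grid := {ffun I -> 'I_(2 * B).+1}.

Definition grid_coord (c : grid) (i : I) : int := (c i)%:Z - B%:Z.

Definition small_grid : {set grid} :=
  [set c : grid | (\sum_i `|grid_coord c i| <= B)%N].

Lemma sum_half_pow n : \sum_(k < n) (2^-1 : R) ^+ k <= 2.
Proof.
suff -> : \sum_(k < n) (2^-1 : R) ^+ k = 2 - 2 * 2^-1 ^+ n.
  by rewrite gerBl mulr_ge0// exprn_ge0.
elim: n => [|n IH]; first by rewrite big_ord0 expr0; lra.
by rewrite big_ord_recr/= IH exprS; lra.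
Qed.

Lemma sum_half_pow_dist :
  \sum_(k < (2 * B).+1) (2^-1 : R) ^+ `|k%:Z - B%:Z|%N <= 3.
Proof.
rewrite -(big_mkord predT (fun k => (2^-1 : R) ^+ `|k%:Z - B%:Z|%N)).
rewrite (big_cat_nat (n := B)) ?leq0n//=; last by lia.
have -> : (3 : R) = 1 + 2 by lra.
apply: lerD.
  rewrite big_nat_rev/= add0n big_mkord.
  rewrite (eq_bigr (fun k : 'I_B => 2^-1 * (2^-1 : R) ^+ k)); last first.
    move=> k _; rewrite -exprS; congr (_ ^+ _).
    by have := ltn_ord k; lia.
  by rewrite -mulr_sumr; have := sum_half_pow B; lra.
rewrite -{1}(add0n B) big_addn big_mkord.
rewrite (eq_bigr (fun k : 'I__ => (2^-1 : R) ^+ k)) ?sum_half_pow// => k _.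
by congr (_ ^+ _); lia.
Qed.

(* Each point of [small_grid] has weight at least [2^-B] under the product of the weights
   [2^-|z|]. *)
Lemma card_small_grid : (#|small_grid|%:R : R) <= 2 ^+ B * 3 ^+ #|I|.
Proof.
rewrite -sumr_const.
apply: (@le_trans _ _
    (\sum_(c : grid) 2 ^+ B * \prod_i (2^-1 : R) ^+ `|grid_coord c i|%N)).
  rewrite [leRHS](bigID (mem small_grid))/=.
  rewrite -[leLHS]addr0; apply: lerD; last first.
    apply: sumr_ge0 => c _; apply: mulr_ge0; first exact: exprn_ge0.
    by apply: prodr_ge0 => i _; exact: exprn_ge0.
  apply: ler_sum => c; rewrite inE => cB.
  rewrite prodrXr -{1}(subnK cB) exprD -mulrA -exprMn mulfV// expr1n mulr1.
  by rewrite exprn_ege1// ler1n.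
rewrite -mulr_sumr ler_wpM2l ?exprn_ge0//.
rewrite -(bigA_distr_bigA (fun i (k : 'I__) => (2^-1 : R) ^+ `|k%:Z - B%:Z|%N)).
rewrite prodr_const; apply: lerXn2r; rewrite ?nnegrE//.
  by apply: sumr_ge0 => k _; exact: exprn_ge0.
exact: sum_half_pow_dist.
Qed.

(** Passes from finitely many points to a whole ball at the price of the rounding cost. [c] is its
    radius in units of [h sqrt #|I|]; the choice of [B] guarantees that the rounded point lies in
    [small_grid]. *)
Lemma uniform_from_lattice (phi : (I -> R) -> R) (A h rho : R) (c : nat)
    (v : I -> R) :
  0 <= A -> 0 < h -> (0 < c)%N -> coord_quadratic phi A ->
  rho = c%:R ^+ 2 * #|I|%:R * h ^+ 2 -> B = (c.+1 * #|I|)%N ->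
  (forall z, z \in small_grid -> 0 <= phi (fun i => h * (grid_coord z i)%:~R)) ->
  \sum_i v i ^+ 2 <= rho -> 0 <= phi v + #|I|%:R * (A * h ^+ 2 / 4).
Proof.
move=> A0 h0 c0 qphi rhoE BE phi0 vrho.
have [z [zv zphi]] := round_lattice v A0 h0 qphi.
have zB := round_lattice_size h0 c0 rhoE vrho zv; rewrite -BE in zB.
have zi i : (`|z i| <= B)%N.
  by apply: leq_trans zB; rewrite (bigD1 i)//= leq_addr.
have zb i : (`|(z i + B%:Z)%R| < (2 * B).+1)%N by have := zi i; lia.
pose k : grid := [ffun i => Ordinal (zb i)].
have kz i : grid_coord k i = z i.
  by rewrite /grid_coord ffunE /=; have := zi i; lia.
have := phi0 k; rewrite inE (eq_bigr (fun i => `|z i|%N)); last first.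
  by move=> i _; rewrite kz.
move=> /(_ zB) /le_trans; apply; apply: le_trans zphi.
rewrite le_eqVlt; apply/orP; left; apply/eqP; congr phi.
by apply/funext => i; rewrite kz.
Qed.

End lattice_points.

Lemma measurable_gt0 d (T : measurableType d) (R : realType) (f : T -> R) :
  measurable_fun setT f -> measurable [set w | 0 < f w].
Proof.
move=> mf; rewrite (_ : [set w | _] = f @^-1` `]0, +oo[%classic); last first.
  by apply/seteqP; split=> w /=; rewrite in_itv/= andbT.
by rewrite -[X in measurable X]setTI; exact: mf.
Qed.

(** * Union and Chernoff bounds *)

Section union_bound.
Context d (T : measurableType d) (R : realType) (P : probability T R).

Lemma union_bound (A : finType) (S : {set A}) (bad : A -> set T) (p : R) :
  (forall a, a \in S -> measurable (bad a)) ->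
  (forall a, a \in S -> P (bad a) <= p%:E)%E ->
  exists E, [/\ measurable E, (P (~` E) <= (#|S|%:R * p)%:E)%E &
    E `<=` \bigcap_(a in [set` S]) ~` bad a].
Proof.
move=> mbad Pbad; pose U := \big[setU/set0]_(a in S) bad a.
have mU : measurable U by apply: bigsetU_measurable.
exists (~` U); split; first exact: measurableC.
  rewrite setCK /U.
  apply: (@le_trans _ _ (\sum_(a in S) P (bad a))%E).
    pose Q (V : set T) (q : \bar R) := measurable V /\ (P V <= q)%E.
    suff [] : Q (\big[setU/set0]_(a in S) bad a) (\sum_(a in S) P (bad a))%E by [].
    apply: (big_ind2 Q) => [|V1 q1 V2 q2 [mV1 Vq1] [mV2 Vq2]|a aS].
    - by split; rewrite ?measure0.
    - split; first exact: measurableU.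
      by apply: le_trans (leeD Vq1 Vq2); exact: measureU2.
    - by split => //; exact: mbad.
  apply: (@le_trans _ _ (\sum_(a in S) p%:E)%E); first exact: lee_sum.
  by rewrite sumEFin sumr_const mulr_natl.
by move=> w Uw a /= aS bw; apply: Uw; rewrite /U (bigD1 a)//=; left.
Qed.

(** The indicator of [0 < f] is at most [expR f]. *)
Lemma expectation_bound (f : T -> R) (p : R) : measurable_fun setT f ->
  (\int[P]_w (expR (f w))%:E <= p%:E)%E ->
  measurable [set w | 0 < f w] /\ (P [set w | (0 < f w)%R] <= p%:E)%E.
Proof.
move=> mf fp; have mA := measurable_gt0 mf.
split => //; apply: le_trans fp.
rewrite -(setIT [set w | _]) -integral_indic//.
apply: ge0_le_integral => //=.
- exact/measurable_EFinP/measurable_indic.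
- by apply/measurable_EFinP/measurableT_comp.
move=> w _; rewrite lee_fin indicE; case: (boolP (w \in _)); last first.
  by rewrite expR_ge0.
by rewrite inE/= => fw; rewrite -expR0 ler_expR ltW.
Qed.

End union_bound.

(** * Linear algebra *)

Lemma sumr_sqr_eq0 (R : realType) (I : finType) (f : I -> R) :
  \sum_i f i ^+ 2 = 0 -> forall i, f i = 0.
Proof.
move=> /eqP; rewrite psumr_eq0 => [/allP f0 i|i _]; last exact: sqr_ge0.
by have := f0 i (mem_index_enum _); rewrite sqrf_eq0 => /eqP.
Qed.

(** * Measurable Gram-Schmidt orthonormalization *)

Section gram_schmidt.
Context (R : realType) (G : finType).
Implicit Types (p q a : G -> R).

Definition dot p q := \sum_g p g * q g.

Lemma dotC p q : dot p q = dot q p.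
Proof. by apply: eq_bigr => g _; rewrite mulrC. Qed.

Lemma dot_ge0 p : 0 <= dot p p.
Proof. by apply: sumr_ge0 => g _; rewrite -expr2 sqr_ge0. Qed.

Lemma dot_eq0 p : dot p p = 0 -> forall g, p g = 0.
Proof. by rewrite /dot; under eq_bigr do rewrite -expr2; exact: sumr_sqr_eq0. Qed.

Lemma dot_suml (n : nat) (c : nat -> R) (p : nat -> G -> R) q :
  dot (fun g => \sum_(i < n) c i * p i g) q = \sum_(i < n) c i * dot (p i) q.
Proof.
rewrite /dot; under eq_bigr do rewrite mulr_suml.
rewrite exchange_big/=; apply: eq_bigr => i _; rewrite mulr_sumr.
by apply: eq_bigr => g _; rewrite mulrA.
Qed.

(* Zero vectors are allowed, so that dependent families need no special
   treatment. *)
Definition orthonormal0 (n : nat) (p : nat -> G -> R) := forall i j,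
  (i < n)%N -> (j < n)%N ->
  (i <> j -> dot (p i) (p j) = 0) /\ (dot (p i) (p i) = 0 \/ dot (p i) (p i) = 1).

Definition in_span (n : nat) (p : nat -> G -> R) a :=
  exists c : nat -> R, forall g, a g = \sum_(i < n) c i * p i g.

Lemma dot_orthonormal0 (n : nat) (p : nat -> G -> R) (c : nat -> R) j :
  orthonormal0 n p -> (j < n)%N ->
  dot (fun g => \sum_(i < n) c i * p i g) (p j) = c j * dot (p j) (p j).
Proof.
move=> op jn; rewrite dot_suml (bigD1 (Ordinal jn))//= big1 ?addr0// => i ij.
have [-> //] := op i j (ltn_ord i) jn; first by rewrite mulr0.
by move=> ijE; move: ij; rewrite -val_eqE/= ijE eqxx.
Qed.

Lemma dot_orthonormal0_sqr (n : nat) (p : nat -> G -> R) (c : nat -> R) :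
  orthonormal0 n p ->
  dot (fun g => \sum_(i < n) c i * p i g) (fun g => \sum_(i < n) c i * p i g) =
  \sum_(i < n) c i ^+ 2 * dot (p i) (p i).
Proof.
move=> op; rewrite dot_suml; apply: eq_bigr => i _.
by rewrite dotC (dot_orthonormal0 c op (ltn_ord i)) mulrA -expr2.
Qed.

Lemma dot_orthonormal0_le (n : nat) (p : nat -> G -> R) (c : nat -> R) :
  orthonormal0 n p ->
  dot (fun g => \sum_(i < n) c i * p i g) (fun g => \sum_(i < n) c i * p i g) <=
  \sum_(i < n) c i ^+ 2.
Proof.
move=> op; rewrite dot_orthonormal0_sqr//; apply: ler_sum => i _.
have [_ [->|->]] := op i i (ltn_ord i) (ltn_ord i).
  by rewrite mulr0 sqr_ge0.
by rewrite mulr1.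
Qed.

(** Multiplying a coefficient by [dot (p i) (p i)], which is 0 or 1, discards those carried by zero
    vectors. *)
Lemma in_span_isometric (n : nat) (p : nat -> G -> R) a :
  orthonormal0 n p -> in_span n p a ->
  exists c : nat -> R, (forall g, a g = \sum_(i < n) c i * p i g) /\
    \sum_(i < n) c i ^+ 2 = dot a a.
Proof.
move=> op [c aE]; exists (fun i => c i * dot (p i) (p i)).
have E g : a g = \sum_(i < n) c i * dot (p i) (p i) * p i g.
  rewrite aE; apply: eq_bigr => i _.
  have [_ [p0|->]] := op i i (ltn_ord i) (ltn_ord i); last by rewrite mulr1.
  by rewrite (dot_eq0 p0) !mulr0.
split=> //.
have -> : a = fun g => \sum_(i < n) c i * p i g by apply/funext.
rewrite dot_orthonormal0_sqr//; apply: eq_bigr => i _.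
have [_ [->|->]] := op i i (ltn_ord i) (ltn_ord i); last by rewrite !mulr1.
by rewrite !mulr0 expr0n.
Qed.

Lemma in_span_sum (n : nat) (p : nat -> G -> R) (K : finType) (y : K -> R)
    (a : K -> G -> R) : (forall k, in_span n p (a k)) ->
  in_span n p (fun g => \sum_k y k * a k g).
Proof.
move=> /choice[c aE]; exists (fun i => \sum_k y k * c k i) => g.
under eq_bigr do rewrite aE mulr_sumr.
rewrite exchange_big/=; apply: eq_bigr => i _; rewrite mulr_suml.
by apply: eq_bigr => k _; rewrite mulrA.
Qed.

Lemma in_spanS (n : nat) (p : nat -> G -> R) a :
  in_span n p a -> in_span n.+1 p a.
Proof.
move=> [c aE]; exists (fun i => if (i < n)%N then c i else 0) => g.
rewrite big_ord_recr/= ltnn mul0r addr0 aE.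
by apply: eq_bigr => i _; rewrite ltn_ord.
Qed.

Lemma measurable_gram_schmidt d (T : measurableType d) (n : nat)
    (a : nat -> T -> G -> R) :
  (forall k g, measurable_fun setT (fun w => a k w g)) ->
  exists p : nat -> T -> G -> R,
    [/\ forall k g, measurable_fun setT (fun w => p k w g),
        forall w, orthonormal0 n (fun k => p k w) &
        forall w k, (k < n)%N -> in_span n (fun k => p k w) (a k w)].
Proof.
move=> ma; elim: n => [|n [p [mp op pa]]].
  by exists (fun _ _ _ => 0); split=> // w i j.
pose r w g := a n w g - \sum_(i < n) dot (a n w) (p i w) * p i w g.
(* Normalizing by a real power is measurable without a case distinction; a zero residual gives a
   zero vector. *)
pose p' k w g := if k == n then dot (r w) (r w) `^ (- 2^-1) * r w g else p k w g.
have p'n w g : p' n w g = dot (r w) (r w) `^ (- 2^-1) * r w g by rewrite /p' eqxx.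
have p'l k : (k < n)%N -> p' k = p k.
  by move=> kn; apply/funext => w; apply/funext => g; rewrite /p' ltn_eqF.
have mr g : measurable_fun setT (fun w => r w g).
  apply: measurable_funB => //; apply: measurable_sum => i.
  apply: measurable_funM => //; apply: measurable_sum => g'.
  exact: measurable_funM.
have rp w j : (j < n)%N -> dot (r w) (p j w) = 0.
  move=> jn.
  have -> : dot (r w) (p j w) = dot (a n w) (p j w) -
      dot (fun g => \sum_(i < n) dot (a n w) (p i w) * p i w g) (p j w).
    by rewrite /dot -sumrB; apply: eq_bigr => g _; rewrite -mulrBl.
  rewrite (dot_orthonormal0 (fun i => dot (a n w) (p i w)) (op w) jn).
  have [_ [p0|->]] := op w j j jn jn; last by rewrite mulr1 subrr.
  rewrite p0 mulr0 subr0 /dot big1// => g _.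
  by rewrite (dot_eq0 p0) mulr0.
have dotp'n w q : dot (p' n w) q = dot (r w) (r w) `^ (- 2^-1) * dot (r w) q.
  by rewrite /dot mulr_sumr; apply: eq_bigr => g _; rewrite p'n mulrA.
have p'p w j : (j < n)%N -> dot (p' n w) (p' j w) = 0.
  by move=> jn; rewrite dotp'n p'l// rp// mulr0.
have p'1 w : dot (p' n w) (p' n w) = 0 \/ dot (p' n w) (p' n w) = 1.
  rewrite dotp'n dotC dotp'n.
  have [r0|r0] := eqVneq (dot (r w) (r w)) 0; first by left; rewrite r0 !mulr0.
  right; rewrite powRN powR12_sqrt ?dot_ge0//.
  have D0 : 0 < Num.sqrt (dot (r w) (r w)).
    by rewrite sqrtr_gt0 lt_neqAle eq_sym r0 dot_ge0.
  by rewrite -{3}(sqr_sqrtr (dot_ge0 (r w))) expr2 mulKf ?mulVf ?gt_eqF.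
exists p'; split.
- move=> k g; have [->|kn] := eqVneq k n; last first.
    by rewrite /p' (negbTE kn).
  rewrite (_ : (fun w => _) = (fun w => dot (r w) (r w) `^ (- 2^-1) * r w g)).
    apply: measurable_funM => //.
    apply: (measurableT_comp (measurable_powR _)).
    by apply: measurable_sum => g'; exact: measurable_funM.
  by apply/funext => w; rewrite p'n.
- move=> w i j; rewrite !ltnS => iN jN; split.
    move: iN jN; rewrite (leq_eqVlt i) (leq_eqVlt j).
    move=> /predU1P[->|iN] /predU1P[->|jN] // ij.
    - exact: p'p.
    - by rewrite dotC p'p.
    - by rewrite !p'l//; apply: (op w i j iN jN).1.
  move: iN; rewrite leq_eqVlt => /predU1P[->//|iN].
  by rewrite p'l//; apply: (op w i i iN iN).2.
- move=> w k; rewrite ltnS leq_eqVlt => /predU1P[->|kn]; last first.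
    apply: in_spanS; have [c aE] := pa w k kn; exists c => g; rewrite aE.
    by apply: eq_bigr => i _; rewrite p'l.
  exists (fun i => if i == n then dot (r w) (r w) `^ 2^-1 else dot (a n w) (p i w)) => g.
  rewrite big_ord_recr/= eqxx p'n.
  rewrite (eq_bigr (fun i : 'I_n => dot (a n w) (p i w) * p i w g)); last first.
    by move=> i _; rewrite p'l// ltn_eqF.
  suff -> : dot (r w) (r w) `^ 2^-1 * (dot (r w) (r w) `^ (- 2^-1) * r w g) = r w g.
    by rewrite /r subrKC.
  have [r0|r0] := eqVneq (dot (r w) (r w)) 0.
    by rewrite (dot_eq0 r0) !mulr0.
  by rewrite powRN mulVKf// gt_eqF// powR_gt0// lt_neqAle eq_sym r0 dot_ge0.
Qed.

End gram_schmidt.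

(** * Quadratic forms and Rayleigh quotients *)

Section quadratic_forms.
Context (R : realType).

Lemma discriminant_le (a b c : R) : 0 <= a -> 0 <= c ->
  (forall t, 0 <= a + 2 * b * t + c * t ^+ 2) -> b ^+ 2 <= a * c.
Proof.
move=> a0 c0 H; have [c_eq0|c_neq0] := eqVneq c 0.
  have [->|b0] := eqVneq b 0; first by rewrite expr0n/= mulr_ge0.
  have := H (- (a + 1) / (2 * b)).
  rewrite c_eq0 mul0r addr0 mulrC divfK ?mulf_neq0//; lra.
have cp : 0 < c by rewrite lt_neqAle eq_sym c_neq0.
have := H (- b / c).
rewrite (_ : _ + _ = (a * c - b ^+ 2) / c); last by field.
by rewrite pmulr_lge0 ?invr_gt0// subr_ge0.
Qed.

Lemma cauchy_schwarz (I : finType) (f g : I -> R) :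
  (\sum_i f i * g i) ^+ 2 <= (\sum_i f i ^+ 2) * (\sum_i g i ^+ 2).
Proof.
apply: discriminant_le; try by apply: sumr_ge0 => i _; exact: sqr_ge0.
move=> t; rewrite (_ : _ + _ = \sum_i (f i + t * g i) ^+ 2).
  by apply: sumr_ge0 => i _; exact: sqr_ge0.
rewrite [RHS](eq_bigr (fun i => f i ^+ 2 + (2 * t * (f i * g i) + t ^+ 2 * g i ^+ 2))).
  by rewrite big_split/= big_split/= -!mulr_sumr; ring.
by move=> i _; ring.
Qed.

Definition bform n (A : 'M[R]_n) (u v : 'cV[R]_n) : R := (u^T *m A *m v) 0 0.
Definition sqnorm n (u : 'cV[R]_n) : R := \sum_k u k 0 ^+ 2.

Lemma sqnorm_ge0 n (u : 'cV[R]_n) : 0 <= sqnorm u.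
Proof. by apply: sumr_ge0 => k _; exact: sqr_ge0. Qed.

Lemma sqnorm_eq0 n (u : 'cV[R]_n) : sqnorm u = 0 -> u = 0.
Proof. by move=> /sumr_sqr_eq0 u0; apply/colP => k; rewrite u0 mxE. Qed.

Lemma sqnormZ n (a : R) (u : 'cV[R]_n) : sqnorm (a *: u) = a ^+ 2 * sqnorm u.
Proof. by rewrite /sqnorm mulr_sumr; apply: eq_bigr => k _; rewrite mxE exprMn. Qed.

Lemma mulTmx_sum n (u v : 'cV[R]_n) : (u^T *m v) 0 0 = \sum_k u k 0 * v k 0.
Proof. by rewrite mxE; apply: eq_bigr => k _; rewrite mxE. Qed.

Lemma sqnormE n (u : 'cV[R]_n) : sqnorm u = (u^T *m u) 0 0.
Proof. by rewrite mulTmx_sum. Qed.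

Lemma sqnorm_mulmx_le m n (M : 'M[R]_(m, n)) :
  exists2 K : R, 0 < K & forall u, sqnorm (M *m u) <= K * sqnorm u.
Proof.
exists (1 + \sum_i \sum_j M i j ^+ 2).
  by rewrite ltr_pwDl// sumr_ge0// => i _; rewrite sumr_ge0// => j _; exact: sqr_ge0.
move=> u; rewrite mulrDl mul1r -[leLHS]add0r lerD ?sqnorm_ge0//.
rewrite mulr_suml ler_sum// => i _; rewrite mxE; exact: cauchy_schwarz.
Qed.

Lemma bformC n (A : 'M[R]_n) u v : A^T = A -> bform A u v = bform A v u.
Proof.
move=> sA; rewrite /bform -[in LHS](trmxK (u^T *m A *m v)) mxE.
by rewrite !trmx_mul trmxK sA mulmxA.
Qed.

Lemma bformZ n (A : 'M[R]_n) a u : bform A (a *: u) (a *: u) = a ^+ 2 * bform A u u.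
Proof.
rewrite /bform (_ : (a *: u)^T = a *: u^T); last first.
  by apply/matrixP => i j; rewrite !mxE.
rewrite -scalemxAr -!scalemxAl scalerA.
have mxZ (b : R) (M : 'M[R]_1) : (b *: M) 0 0 = b * M 0 0 by rewrite mxE.
by rewrite mxZ.
Qed.

Lemma bform_cauchy_schwarz n (A : 'M[R]_n) u v : A^T = A ->
  (forall w, 0 <= bform A w w) ->
  bform A u v ^+ 2 <= bform A u u * bform A v v.
Proof.
move=> sA A0; apply: discriminant_le => // t.
suff -> : bform A u u + 2 * bform A u v * t + bform A v v * t ^+ 2 =
    bform A (u + t *: v) (u + t *: v) by [].
have vu := bformC u v sA; rewrite /bform in vu *.
have -> : (u + t *: v)^T = u^T + t *: v^T by apply/matrixP => i j; rewrite !mxE.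
rewrite !mulmxDl !mulmxDr -!scalemxAl -!scalemxAr.
have mxD (M N : 'M[R]_1) : (M + N) 0 0 = M 0 0 + N 0 0 by rewrite mxE.
have mxZ (a : R) (M : 'M[R]_1) : (a *: M) 0 0 = a * M 0 0 by rewrite mxE.
by rewrite !(mxD, mxZ) -vu; ring.
Qed.

(** The infimum [r] of the form over the unit sphere is an eigenvalue: otherwise [A - r] is positive
    semidefinite and invertible, hence bounded below by a positive multiple of the identity, and [r]
    would not be the infimum. *)
Lemma lambda_min_rayleigh n (A : 'M[R]_n) (c : R) : (0 < n)%N -> A^T = A ->
  (forall u, c * sqnorm u <= bform A u u) ->
  c <= lambda_min A /\ forall u, lambda_min A * sqnorm u <= bform A u u.
Proof.
move=> n0 sA cA.
pose S := [set bform A u u | u in [set u | sqnorm u = 1]].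
have Slb : has_lbound S by exists c => _ [u /= u1 <-]; have := cA u; rewrite u1 mulr1.
have Snz : S !=set0.
  exists (bform A (delta_mx (Ordinal n0) 0) (delta_mx (Ordinal n0) 0)).
  exists (delta_mx (Ordinal n0) 0) => //=.
  rewrite /sqnorm (bigD1 (Ordinal n0))//= mxE !eqxx expr1n big1 ?addr0// => k k0.
  by rewrite mxE (negbTE k0) expr0n.
pose r := inf S.
have rS u : r * sqnorm u <= bform A u u.
  have [u0|u0] := eqVneq (sqnorm u) 0.
    by rewrite u0 mulr0 (sqnorm_eq0 u0) /bform mulmx0 mxE.
  have up : 0 < sqnorm u by rewrite lt_neqAle eq_sym u0 sqnorm_ge0.
  pose s := Num.sqrt (sqnorm u).
  have s0 : s != 0 by rewrite gt_eqF// sqrtr_gt0.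
  have : r <= bform A (s^-1 *: u) (s^-1 *: u).
    apply: ge_inf => //; exists (s^-1 *: u) => //=.
    by rewrite sqnormZ exprVn sqr_sqrtr ?(ltW up)// mulVf.
  by rewrite bformZ exprVn sqr_sqrtr ?(ltW up)// mulrC ler_pdivlMr.
have eigv a : eigenvalue A a -> exists2 u, sqnorm u != 0 & bform A u u = a * sqnorm u.
  move=> /eigenvalueP[v vA v0]; exists v^T.
    apply: contra v0 => /eqP/sqnorm_eq0/(congr1 trmx); rewrite trmxK => ->.
    by rewrite trmx0.
  by rewrite /bform trmxK vA -scalemxAl mxE sqnormE trmxK.
have eig_ge a : eigenvalue A a -> r <= a /\ c <= a.
  move=> /eigv[u u0 uA].
  have up : 0 < sqnorm u by rewrite lt_neqAle eq_sym u0 sqnorm_ge0.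
  by split; rewrite -(ler_pM2r up) -uA.
have reig : eigenvalue A r.
  have [//|nr] := boolP (eigenvalue A r); exfalso; pose B := A - r%:M.
  have sB : B^T = B by rewrite /B linearB/= sA tr_scalar_mx.
  have BE u : bform B u u = bform A u u - r * sqnorm u.
    by rewrite /bform /B mulmxBr mulmxBl mul_mx_scalar -scalemxAl sqnormE !mxE.
  have B0 u : 0 <= bform B u u by rewrite BE subr_ge0.
  have uB : B \in unitmx.
    rewrite -row_free_unit -kermx_eq0; move: nr.
    by rewrite /eigenvalue /eigenspace negbK.
  have [K K0 HK] := sqnorm_mulmx_le B.
  have [K' K'0 HK'] := sqnorm_mulmx_le (invmx B).
  have HB w : bform B w w <= (1 + K) * sqnorm w.
    have : 0 <= sqnorm (w - B *m w) by exact: sqnorm_ge0.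
    have -> : sqnorm (w - B *m w) = sqnorm w - 2 * bform B w w + sqnorm (B *m w).
      rewrite /bform -mulmxA mulTmx_sum /sqnorm mulr_sumr -sumrB -big_split/=.
      by apply: eq_bigr => k _; rewrite !mxE; ring.
    by have := HK w; have := B0 w; lra.
  (* Cauchy-Schwarz for the form [B] at [u] and [B u] gives [|B u|^4 <= B(u, u) (1 + K) |B u|^2];
     the bounded inverse then turns [|B u|] into [|u|]. *)
  have H u : sqnorm u <= K' * ((1 + K) * bform B u u).
    have -> : sqnorm u = sqnorm (invmx B *m (B *m u)) by rewrite mulKmx.
    apply: (le_trans (HK' _)); rewrite ler_pM2l//.
    have [->|Bu0] := eqVneq (sqnorm (B *m u)) 0.
      by rewrite mulr_ge0// addr_ge0 ?ltW.
    have Bup : 0 < sqnorm (B *m u) by rewrite lt_neqAle eq_sym Bu0 sqnorm_ge0.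
    have := bform_cauchy_schwarz u (B *m u) sB B0.
    have -> : bform B u (B *m u) = sqnorm (B *m u).
      by rewrite /bform sqnormE trmx_mul sB.
    move=> H2; have H1 := ler_wpM2l (B0 u) (HB (B *m u)).
    rewrite -(ler_pM2l Bup) -[leLHS]expr2.
    apply: (le_trans H2); apply: (le_trans H1).
    by rewrite le_eqVlt; apply/orP; left; apply/eqP; ring.
  have KK : 0 < (K' * (1 + K))^-1 by rewrite invr_gt0 mulr_gt0// addr_gt0.
  have [_ [u /= u1 <-]] := inf_adherent KK (conj Snz Slb).
  rewrite -/r => ult; have := H u; rewrite u1 BE u1 mulr1.
  have : (K' * (1 + K)) * (bform A u u - r) < 1.
    rewrite mulrC -ltr_pdivlMr ?mul1r ?mulr_gt0 ?addr_gt0//.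
    by rewrite ltrBlDl.
  by rewrite mulrA => /lt_geF ->.
have Elb : has_lbound [set a : R | eigenvalue A a] by exists r => a /= /eig_ge[].
have lr : lambda_min A <= r by apply: ge_inf.
split.
  apply: lb_le_inf; first by exists r.
  by move=> a /= /eig_ge[].
by move=> u; apply: le_trans (rS u); rewrite ler_wpM2r// sqnorm_ge0.
Qed.

End quadratic_forms.

(** * The deterministic least-squares error *)

Section least_squares.
Context (R : realType).

Lemma opnorm_le p q (M : 'M[R]_(p, q)) (c : R) : 0 <= c ->
  (forall v, sqnorm v <= 1 -> sqnorm (M *m v) <= c ^+ 2) -> opnorm M <= c.
Proof.
move=> c0 Mc; apply: ge_sup.
  by exists (enorm (M *m 0)); exists 0 => //=; rewrite /enorm big1 ?sqrtr0// => k _;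
    rewrite mxE expr0n.
move=> _ [v /= v1 <-]; rewrite -(ger0_norm c0) -sqrtr_sqr ler_wsqrtr// Mc//.
have := sqnorm_ge0 v; rewrite /sqnorm => s0.
by rewrite -(sqr_sqrtr s0) exprn_ile1// sqrtr_ge0.
Qed.

Context (G : finType) (n l : nat) (X : G -> 'cV[R]_n) (N : G -> 'cV[R]_l).

Let Xdot (y : 'cV[R]_n) (g : G) : R := \sum_k X g k 0 * y k 0.
Let energy (y : 'cV[R]_n) : R := \sum_g Xdot y g ^+ 2.

Let gram := \sum_g X g *m (X g)^T.

Lemma gram_energy y : (y^T *m gram *m y) 0 0 = energy y.
Proof.
rewrite /gram mulmx_sumr mulmx_suml summxE; apply: eq_bigr => g _.
rewrite mulmxA -mulmxA mxE big_ord1 expr2 /Xdot; congr (_ * _).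
  by rewrite mulTmx_sum; apply: eq_bigr => k _; rewrite mulrC.
by rewrite mulTmx_sum.
Qed.

(** For a unit [v] put [y = gram^-1 v], of energy at most [1 / Lam]. The error at [v] is [z = S y],
    and testing the noise hypothesis with this same [z] gives
    [|z|^2 <= beta |z| sqrt (energy y)]. *)
Lemma least_squares_error (Theta : 'M[R]_(l, n)) (Lam beta : R) :
  0 < Lam -> 0 <= beta ->
  (forall y, Lam * sqnorm y <= energy y) ->
  (forall (z : 'cV[R]_l) y, \sum_g (\sum_k z k 0 * N g k 0) * Xdot y g
      <= beta * Num.sqrt (sqnorm z) * Num.sqrt (energy y)) ->
  opnorm ((\sum_g (Theta *m X g + N g) *m (X g)^T) *m invmx gram - Theta)
    <= beta / Num.sqrt Lam.
Proof.
move=> L0 beta0 HX HN.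
(* [invmx] is the identity function on singular matrices, so invertibility has to be established
   first. *)
have ugram : gram \in unitmx.
  rewrite -row_free_unit -kermx_eq0; apply/negPn/negP => /rowV0Pn[v].
  move=> /sub_kermxP vg v0; have := HX v^T.
  rewrite -gram_energy trmxK vg mul0mx mxE => H.
  have s0 : sqnorm v^T = 0.
    by apply/eqP; rewrite eq_le sqnorm_ge0 andbT -(ler_pM2l L0) mulr0.
  by move: v0; rewrite -(trmxK v) (sqnorm_eq0 s0) trmx0 eqxx.
pose S := \sum_g N g *m (X g)^T.
have -> : (\sum_g (Theta *m X g + N g) *m (X g)^T) *m invmx gram - Theta
    = S *m invmx gram.
  under eq_bigr do rewrite mulmxDl -mulmxA.
  by rewrite big_split/= -mulmx_sumr mulmxDl mulmxK// addrC addKr.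
apply: opnorm_le; first by rewrite divr_ge0// sqrtr_ge0.
move=> v v1; rewrite -mulmxA; set y := invmx gram *m v.
set z := S *m y.
have ey0 : 0 <= energy y by apply: sumr_ge0 => g _; exact: sqr_ge0.
(* [energy y] is the scalar product of [y] and [v], so its square is at most
   [|y|^2 <= energy y / Lam]. *)
have ey : energy y <= Lam^-1.
  have E : energy y = \sum_k y k 0 * v k 0.
    by rewrite -gram_energy -mulmxA /y mulKVmx// -/y mulTmx_sum.
  have : energy y ^+ 2 <= Lam^-1 * energy y.
    rewrite {1}E; apply: (le_trans (cauchy_schwarz _ _)).
    apply: (@le_trans _ _ (sqnorm y)).
      by rewrite ler_piMr// ?sqnorm_ge0.
    by rewrite mulrC ler_pdivlMr// mulrC HX.
  have [->|ey1] := eqVneq (energy y) 0; first by rewrite invr_ge0 (ltW L0).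
  by rewrite expr2 ler_pM2r// lt_neqAle eq_sym ey1.
have zE : sqnorm z = \sum_g (\sum_k z k 0 * N g k 0) * Xdot y g.
  rewrite /sqnorm; under eq_bigr do rewrite expr2.
  rewrite (eq_bigr (fun k => \sum_g z k 0 * N g k 0 * Xdot y g)).
    rewrite exchange_big/=; apply: eq_bigr => g _.
    by rewrite mulr_suml.
  move=> k _; rewrite -[LHS]mulr1 mulr1 {2}/z /S mulmx_suml summxE mulr_sumr.
  apply: eq_bigr => g _; rewrite -mulrA; congr (_ * _).
  by rewrite -mulmxA mxE big_ord1; congr (_ * _); rewrite mulTmx_sum.
rewrite exprMn exprVn sqr_sqrtr ?(ltW L0)//.
have [->|z1] := eqVneq (sqnorm z) 0.
  by rewrite mulr_ge0 ?sqr_ge0// invr_ge0 (ltW L0).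
have zp : 0 < sqnorm z by rewrite lt_neqAle eq_sym z1 sqnorm_ge0.
have sz : 0 < Num.sqrt (sqnorm z) by rewrite sqrtr_gt0.
have H : Num.sqrt (sqnorm z) <= beta * Num.sqrt (energy y).
  rewrite -(ler_pM2l sz) -[leLHS]expr2 sqr_sqrtr ?(ltW zp)//.
  by rewrite {1}zE mulrCA mulrA; exact: HN.
rewrite -{1}(sqr_sqrtr (ltW zp)).
apply: (@le_trans _ _ ((beta * Num.sqrt (energy y)) ^+ 2)).
  by rewrite lerXn2r// nnegrE ?sqrtr_ge0// mulr_ge0// sqrtr_ge0.
by rewrite exprMn sqr_sqrtr// ler_wpM2l// sqr_ge0.
Qed.

End least_squares.

(** * Tail bounds *)

Lemma mutually_independent_comp d (T : measurableType d) (R : realType)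
    (P : probability T R) (I I' : choiceType) (Z : I -> {RV P >-> R})
    (f : I' -> I) :
  injective f -> mutually_independent P Z -> mutually_independent P (Z \o f).
Proof.
move=> finj indep F B mB.
(* Transports [B] along the injection [f], leaving indices outside its range unconstrained. *)
pose C c := if pselect (exists i, f i = c) is left h then B (projT1 (cid h)) else setT.
have Cf i : C (f i) = B i.
  rewrite /C; case: pselect => [h|]; last by case; exists i.
  by case: cid => j /= /finj ->.
have mC c : measurable (C c) by rewrite /C; case: pselect => // h; exact: mB.
have := indep (f @` F)%fset C mC.
rewrite big_imfset/=; last by move=> i j _ _ /finj.
under eq_bigr do rewrite Cf.
move=> <-; congr (P _); apply/seteqP; split => w Bw c /=.
  by move=> /imfsetP[i /= iF ->]; rewrite Cf; exact: Bw.
by move=> cF; have := Bw (f c); rewrite /= Cf; apply; exact: in_imfset.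
Qed.

(** * Numerical estimates of the exponential *)

Section exp_bounds.
Context (R : realType).
Implicit Types t : R.

Lemma expR_chord (c b t : R) : 0 < b -> 0 <= t <= b ->
  expR (c * t) <= 1 + t / b * (expR (c * b) - 1).
Proof.
move=> b0 /andP[t0 tb]; have tb0 : 0 <= t / b by rewrite divr_ge0// ltW.
have tb1 : t / b <= 1 by rewrite ler_pdivrMr ?mul1r.
have := convex_expR (Itv01 tb0 tb1) (c * b) 0; rewrite !convRE/= expR0.
by rewrite mulr0 addr0 mulrCA divfK ?gt_eqF// mulr1 /unstable.onem; lra.
Qed.

(** The chord over [[0, 4]] has slope at most 1 because [exp (3/2) <= 5]. It bounds the
    normalization [sqrt (1 + t)] of the lower tail. *)
Lemma expR_le_1D t : 0 <= t <= 4 -> expR (3 / 8 * t) <= 1 + t.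
Proof.
move=> t04; have e8 : expR (8^-1 : R) <= 8 / 7.
  have : expR (- 8^-1 : R) >= 7 / 8 by apply: le_trans (expR_ge1Dx _); lra.
  rewrite expRN => H; rewrite -[leLHS]invrK -[leRHS]invrK lef_pV2 ?posrE ?invr_gt0 ?expR_gt0//.
    by apply: le_trans H; rewrite invf_div.
have e12 : expR (3 / 2 : R) <= 5.
  have -> : (3 / 2 : R) = 12%:R * 8^-1 by lra.
  rewrite expRM_natl.
  apply: (@le_trans _ _ ((8 / 7) ^+ 12)); last by lra.
  by rewrite lerXn2r// nnegrE ?expR_ge0//; lra.
have := @expR_chord (3 / 8) 4 t (ltr0n _ 4) t04.
rewrite (_ : 3 / 8 * 4 = 3 / 2 :> R); last by lra.
have /andP[t0 _] := t04; have : t / 4 * (expR (3 / 2) - 1) <= t; last by lra.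
have : t / 4 * (expR (3 / 2) - 1) <= t / 4 * 4; last by lra.
by rewrite ler_wpM2l//; lra.
Qed.

(** The chord over [[0, 1/2]], with [exp (-3/4) <= 1/2]; used for the upper tail. *)
Lemma expR_le_1B t : 0 <= t <= 2^-1 -> expR (- (3 / 2) * t) <= 1 - t.
Proof.
move=> t01.
have e34 : 2 <= expR (3 / 4 : R).
  have -> : (3 / 4 : R) = 8%:R * (3 / 32) by lra.
  rewrite expRM_natl.
  apply: (@le_trans _ _ ((35 / 32) ^+ 8)); first by lra.
  rewrite lerXn2r// ?nnegrE ?expR_ge0//.
  by apply: le_trans (expR_ge1Dx _); lra.
have := @expR_chord (- (3 / 2)) 2^-1 t _ t01; rewrite invr_gt0 ltr0n => /(_ isT).
rewrite (_ : - (3 / 2) * 2^-1 = - (3 / 4) :> R); last by lra.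
have e34' : expR (- (3 / 4) : R) <= 2^-1.
  by rewrite expRN lef_pV2// posrE ?expR_gt0.
have /andP[t0 _] := t01.
have : t / 2^-1 * (expR (- (3 / 4)) - 1) <= - t; last by lra.
have : t / 2^-1 * (expR (- (3 / 4)) - 1) <= t / 2^-1 * (- 2^-1); last first.
  by rewrite invrK; lra.
by rewrite ler_wpM2l ?invrK//; lra.
Qed.

Lemma expR_ge_pow (x : R) (k : nat) : 0 <= 1 + x ->
  (1 + x) ^+ k <= expR (k%:R * x).
Proof.
move=> x0; rewrite expRM_natl lerXn2r// ?nnegrE ?expR_ge0//.
exact: expR_ge1Dx.
Qed.

(** Pays for the [24^n] lattice points of the design. *)
Lemma expR_ge24 : 24 <= expR (7 / 2 : R).
Proof.
have -> : (7 / 2 : R) = 28%:R * 8^-1 by lra.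
by apply: le_trans (expR_ge_pow _ _); lra.
Qed.

(** Pays for the [12^(n + l)] lattice points of the noise. *)
Lemma expR_ge12 : 12 <= expR (64 / 25 : R).
Proof.
by apply: le_trans (expR_ge_pow 64 _); lra.
Qed.

(** Pays for the union over the [n] basis vectors. *)
Lemma nat_le_expR_half (k : nat) : k%:R <= expR (k%:R / 2 : R).
Proof.
have k0 : (0 : R) <= k%:R by [].
have -> : (k%:R / 2 : R) = 2%:R * (k%:R / 4) by lra.
by apply: le_trans (expR_ge_pow _ _); have := sqr_ge0 (1 - k%:R / 4 : R); lra.
Qed.

End exp_bounds.

(** * Lower bound on the energy of the design *)

Section design_energy.
Context d (T : measurableType d) (R : realType) (P : probability T R).
Context (G K L : finType) (W : (G * K) + (G * L) -> {RV P >-> R}).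
Context (mu : G -> K -> R) (sx : R).
Hypothesis indep : mutually_independent P W.
Hypothesis sx0 : 0 < sx.
Hypothesis nx : forall g k, is_normal (W (inl (g, k))) (mu g k) sx.

Definition design (u : K -> R) (g : G) (w : T) : R :=
  \sum_k u k * W (inl (g, k)) w.
Definition mean_design (u : K -> R) (g : G) : R := \sum_k u k * mu g k.
(** The quadratic form of [V - sum mu mu^T], whose expectation is [N sx^2 |u|^2]. *)
Definition excess (u : K -> R) (w : T) : R :=
  \sum_g design u g w ^+ 2 - \sum_g mean_design u g ^+ 2.

Lemma measurable_design u g : measurable_fun setT (design u g).
Proof. by apply: measurable_sum => k; exact: measurable_funM. Qed.

Lemma measurable_excess u : measurable_fun setT (excess u).
Proof.
apply: measurable_funB => //; apply: measurable_sum => g.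
by apply: measurable_funX; exact: measurable_design.
Qed.

Let N : R := #|G|%:R.

Lemma mgf_excess u (a c : R) (k := 1 + 2 * a * sx ^+ 2 * \sum_i u i ^+ 2) :
  0 < k ->
  (\int[P]_w (expR (c - a * excess u w))%:E =
   (expR (c + a * (1 - k^-1) * \sum_g mean_design u g ^+ 2)
     / Num.sqrt k ^+ #|G|)%:E)%E.
Proof.
move=> k0; pose mn (i : (G * K) + (G * L)) : R :=
  match i with inl p => mu p.1 p.2 | inr _ => 0 end.
have := @expectation_sqr_prod _ _ _ P _ W mn sx indep (lt0r_neq0 sx0) G K
  (fun g k => inl (g, k)) u a (enum G).
rewrite -/k => /(_ _ _ k0 (enum_uniq G)) H.
set S := \sum_g mean_design u g ^+ 2.
under eq_integral => w _.
  rewrite (_ : expR _ = expR (c + a * S) *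
      expR (- a * \sum_(g <- enum G) (\sum_i u i * W (inl (g, i)) w) ^+ 2)).
    rewrite EFinM; over.
  by rewrite -expRD big_enum/=; congr expR; rewrite /excess -/S /design; ring.
rewrite ge0_integralZl ?lee_fin ?expR_ge0//; last first.
- apply/measurable_EFinP/measurableT_comp => //.
  apply: measurable_funM => //; apply: measurable_sum => g.
  by apply: measurable_funX; exact: measurable_design.
rewrite H; last 2 first.
- by move=> g i g' i' [-> ->].
- by move=> g i; exact: nx.
rewrite -EFinM -cardE mulrA -expRD big_enum/=.
congr (expR _ / _)%:E; rewrite /mn/= -/(mean_design u _).
by rewrite -[X in _ * X / _]/S; ring.
Qed.

Variables (muh ell : R).
Let n : R := #|K|%:R.
Hypothesis ell0 : 0 < ell.
Hypothesis n0 : 1 <= n.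
Hypothesis hmu : forall g, \sum_k mu g k ^+ 2 <= muh ^+ 2.
Hypothesis hN : 8 * n + 16 * ell <= N.
Hypothesis hN2 : 256 * muh ^+ 2 * (4 * n + 2 * ell) <= N * sx ^+ 2.

Let N0 : 0 < N.
Proof. by apply: lt_le_trans hN; move: n0 ell0; lra. Qed.

Lemma mean_design_le u :
  \sum_g mean_design u g ^+ 2 <= N * muh ^+ 2 * \sum_k u k ^+ 2.
Proof.
apply: (@le_trans _ _ (\sum_(g : G) (\sum_k u k ^+ 2) * muh ^+ 2)).
  apply: ler_sum => g _; apply: (le_trans (cauchy_schwarz _ _)).
  by rewrite ler_wpM2l// sumr_ge0// => k _; exact: sqr_ge0.
by rewrite sumr_const -[_ *+ _]mulr_natl -/N le_eqVlt; apply/orP; left; apply/eqP; ring.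
Qed.

(** In units of [t N / 64] the exponent is 4 from the threshold, plus at most 1 from the means,
    minus 12 from the normalization. Since [t N = 8 (4 n + 2 ell)], the total -7 is
    [-(7/2 n + 7/4 ell)]. *)
Lemma excess_lower_tail u :
  let f w := N * sx ^+ 2 / 8 * \sum_k u k ^+ 2 - excess u w in
  measurable [set w | 0 < f w] /\
  (P [set w | (0 < f w)%R] <= (expR (- (7 / 2 * n + ell)))%:E)%E.
Proof.
rewrite /=; set U := \sum_k u k ^+ 2.
pose f w := N * sx ^+ 2 / 8 * U - excess u w.
rewrite -/(f _); change (measurable [set w | 0 < f w] /\
  (P [set w | (0 < f w)%R] <= (expR (- (7 / 2 * n + ell)))%:E)%E).
(* The Chernoff parameter divides by [U]; for [U = 0] the strict inequality makes the event
   empty. *)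
have [U0|U_neq0] := eqVneq U 0.
  have u0 := sumr_sqr_eq0 U0.
  have -> : [set w | 0 < f w] = set0.
    apply/seteqP; split=> w //=; rewrite /f U0 mulr0 /excess.
    rewrite !big1 ?subrr ?ltxx// => g _.
      by rewrite /mean_design big1 ?expr0n// => k _; rewrite u0 mul0r.
    by rewrite /design big1 ?expr0n// => k _; rewrite u0 mul0r.
  by rewrite measure0; split => //; rewrite lee_fin expR_ge0.
have Up : 0 < U.
  by rewrite lt_neqAle eq_sym U_neq0 sumr_ge0// => k _; exact: sqr_ge0.
have s2 : 0 < sx ^+ 2 by rewrite exprn_gt0.
(* Chernoff parameter: [t <= 4] by [hN], and [t muh^2 / sx^2 <= 1 / 32] by
   [hN2]. *)
pose t := 8 * (4 * n + 2 * ell) / N.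
pose a := t / (2 * sx ^+ 2 * U).
have [n1 l1 hN1 hN21] := And4 n0 ell0 hN hN2.
have t0 : 0 < t by rewrite divr_gt0// mulr_gt0//; lra.
have t4 : t <= 4 by rewrite ler_pdivrMr//; lra.
have a0 : 0 < a by rewrite divr_gt0// !mulr_gt0.
have -> : [set w | 0 < f w] = [set w | 0 < a * f w].
  by apply/seteqP; split=> w /=; rewrite pmulr_rgt0.
apply: expectation_bound.
  by apply: measurable_funM => //; apply: measurable_funB => //; exact: measurable_excess.
have kE : 1 + 2 * a * sx ^+ 2 * U = 1 + t by rewrite /a; field; rewrite !gt_eqF.
have k0 : 0 < 1 + 2 * a * sx ^+ 2 * U by rewrite kE; lra.
under eq_integral do rewrite /f mulrBr.
rewrite mgf_excess// -/U kE lee_fin.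
rewrite ler_pdivrMr ?exprn_gt0 ?sqrtr_gt0//; last lra.
have st : expR (3 / 16 * t) <= Num.sqrt (1 + t).
  rewrite -(ger0_norm (expR_ge0 (3 / 16 * t))) -sqrtr_sqr ler_wsqrtr//.
  rewrite -expRM_natl (_ : 2%:R * _ = 3 / 8 * t); last by lra.
  by apply: expR_le_1D; rewrite ltW.
apply: (@le_trans _ _ (expR (- (7 / 2 * n + ell)) * expR (N * (3 / 16 * t)))); last first.
  by rewrite ler_wpM2l ?expR_ge0// expRM_natl lerXn2r// nnegrE ?expR_ge0 ?sqrtr_ge0.
rewrite -expRD ler_expR.
have tN : t * N = 8 * (4 * n + 2 * ell) by rewrite /t divfK// gt_eqF.
have aU : a * (N * sx ^+ 2 / 8 * U) = t * N / 16.
  by rewrite /a; field; rewrite !gt_eqF.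
have aM : a * (1 - (1 + t)^-1) * \sum_g mean_design u g ^+ 2 <= t * N / 64.
  have t1 : 0 <= 1 - (1 + t)^-1 <= t.
    rewrite subr_ge0 invf_le1 ?lerDl ?(ltW t0)/=; last lra.
    rewrite (_ : 1 - _ = t / (1 + t)); last by field; lra.
    by rewrite ler_pdivrMr; nra.
  have /andP[t1l t1u] := t1.
  apply: (@le_trans _ _ (a * t * (N * muh ^+ 2 * U))).
    rewrite ler_pM ?mean_design_le//.
    - by rewrite mulr_ge0// ltW.
    - by apply: sumr_ge0 => g _; exact: sqr_ge0.
    - by rewrite ler_wpM2l// ltW.
  rewrite (_ : a * t * _ = t / (2 * sx ^+ 2) * (t * N * muh ^+ 2)); last first.
    by rewrite /a; field; rewrite !gt_eqF.
  rewrite (_ : t * N / 64 = t / (2 * sx ^+ 2) * (N * sx ^+ 2 / 32)); last first.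
    by field; rewrite !gt_eqF.
  rewrite tN ler_wpM2l//; last by move: hN21; lra.
  by rewrite ltW// divr_gt0// mulr_gt0.
by move: aM; rewrite aU; lra.
Qed.

Lemma sum_basis (f : K -> R) k : \sum_j (j == k)%:R * f j = f k.
Proof.
rewrite (bigD1 k)//= eqxx mul1r big1 ?addr0// => j /negbTE ->.
by rewrite mul0r.
Qed.

(** The constant [57/32] balances the exponent: in units of [t N / 64] it is -57 from the threshold,
    at most 1 from the means and 48 from the normalization, and [t N / 8 = n / 2 + ell]. *)
Lemma excess_upper_tail k :
  let f w := excess (fun j => (j == k)%:R) w - 57 / 32 * N * sx ^+ 2 in
  measurable [set w | 0 < f w] /\
  (P [set w | (0 < f w)%R] <= (expR (- (n / 2 + ell)))%:E)%E.
Proof.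
pose u j : R := (j == k)%:R; pose f w := excess u w - 57 / 32 * N * sx ^+ 2.
change (measurable [set w | 0 < f w] /\
  (P [set w | (0 < f w)%R] <= (expR (- (n / 2 + ell)))%:E)%E).
have U1 : \sum_j u j ^+ 2 = 1.
  under eq_bigr do rewrite expr2.
  by rewrite sum_basis /u eqxx.
have [n1 l1 hN1 hN21] := And4 n0 ell0 hN hN2.
have s2 : 0 < sx ^+ 2 by rewrite exprn_gt0.
pose t := 4 * (n + 2 * ell) / N.
have t0 : 0 < t by rewrite divr_gt0// mulr_gt0//; lra.
have t2 : t <= 2^-1 by rewrite ler_pdivrMr//; lra.
pose a := - (t / (2 * sx ^+ 2)).
have a0 : 0 < - a by rewrite opprK divr_gt0// mulr_gt0.
have -> : [set w | 0 < f w] = [set w | 0 < - a * f w].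
  by apply/seteqP; split=> w /=; rewrite pmulr_rgt0.
apply: expectation_bound.
  by apply: measurable_funM => //; apply: measurable_funB => //; exact: measurable_excess.
have kE : 1 + 2 * a * sx ^+ 2 * \sum_j u j ^+ 2 = 1 - t.
  by rewrite U1 /a; field; rewrite !gt_eqF.
have k0 : 0 < 1 + 2 * a * sx ^+ 2 * \sum_j u j ^+ 2 by rewrite kE; lra.
under eq_integral => w _.
  rewrite (_ : - a * f w = a * (57 / 32 * N * sx ^+ 2) - a * excess u w); last first.
    by rewrite /f; ring.
  over.
rewrite mgf_excess// kE lee_fin.
rewrite ler_pdivrMr ?exprn_gt0 ?sqrtr_gt0//; last lra.
have st : expR (- (3 / 4) * t) <= Num.sqrt (1 - t).
  rewrite -(ger0_norm (expR_ge0 (- (3 / 4) * t))) -sqrtr_sqr ler_wsqrtr//.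
  rewrite -expRM_natl (_ : 2%:R * _ = - (3 / 2) * t); last by lra.
  by apply: expR_le_1B; rewrite ltW.
apply: (@le_trans _ _ (expR (- (n / 2 + ell)) * expR (N * (- (3 / 4) * t)))); last first.
  by rewrite ler_wpM2l ?expR_ge0// expRM_natl lerXn2r// nnegrE ?expR_ge0 ?sqrtr_ge0.
rewrite -expRD ler_expR.
have tN : t * N = 4 * (n + 2 * ell) by rewrite /t divfK// gt_eqF.
have aU : a * (57 / 32 * N * sx ^+ 2) = - (57 / 64 * (t * N)).
  by rewrite /a; field; rewrite !gt_eqF.
have aM : a * (1 - (1 - t)^-1) * \sum_g mean_design u g ^+ 2 <= t * N / 64.
  have E : a * (1 - (1 - t)^-1) = t / (2 * sx ^+ 2) * (t / (1 - t)).
    by rewrite /a; field; rewrite !gt_eqF//; lra.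
  have t1 : 0 <= t / (1 - t) <= 2 * t.
    rewrite divr_ge0 ?(ltW t0)//=; last lra.
    have tt : 0 <= t * (2^-1 - t) by rewrite mulr_ge0// ?(ltW t0)//; lra.
    by rewrite ler_pdivrMr; move: tt; lra.
  have /andP[t1l t1u] := t1.
  have c0 : 0 <= t / (2 * sx ^+ 2) by rewrite ltW// divr_gt0// mulr_gt0.
  rewrite E; apply: (@le_trans _ _ (t / (2 * sx ^+ 2) * (2 * t) * (N * muh ^+ 2))).
    rewrite ler_pM//.
    - by rewrite mulr_ge0.
    - by apply: sumr_ge0 => g _; exact: sqr_ge0.
    - by rewrite ler_wpM2l.
    - by have := mean_design_le u; rewrite U1 mulr1.
  rewrite (_ : t / (2 * sx ^+ 2) * (2 * t) * _ =
      t / (2 * sx ^+ 2) * (2 * (t * N) * muh ^+ 2)); last by ring.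
  rewrite (_ : t * N / 64 = t / (2 * sx ^+ 2) * (N * sx ^+ 2 / 32)); last first.
    by field; rewrite !gt_eqF.
  rewrite tN ler_wpM2l//.
  have : 0 <= muh ^+ 2 * n by rewrite mulr_ge0 ?sqr_ge0//; lra.
  by move: hN21; lra.
by move: aM; rewrite aU; lra.
Qed.

Lemma shift_at_sum (v : K -> R) i e (f : K -> R) :
  \sum_k shift_at v i e k * f k = \sum_k v k * f k + e * f i.
Proof.
rewrite (bigD1 i)//= [in RHS](bigD1 i)//= {1}/shift_at eqxx mulrDl addrAC.
congr (_ + _ + _); apply: eq_bigr => k /negbTE ki.
by rewrite /shift_at ki.
Qed.

Lemma shift_at_sqr (v : K -> R) i e :
  \sum_k shift_at v i e k ^+ 2 = \sum_k v k ^+ 2 + 2 * v i * e + e ^+ 2.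
Proof.
rewrite (bigD1 i)//= [in RHS](bigD1 i)//= {1}/shift_at eqxx.
under eq_bigr => k /negbTE ki do rewrite /shift_at ki.
by ring.
Qed.

Lemma excessZ c v w : excess (fun k => c * v k) w = c ^+ 2 * excess v w.
Proof.
rewrite /excess mulrBr !mulr_sumr; congr (_ - _); apply: eq_bigr => g _;
  rewrite -exprMn; congr (_ ^+ 2); rewrite mulr_sumr; apply: eq_bigr => k _;
  by rewrite mulrA.
Qed.

(* Lattice step [1 / (2 sqrt n)]: at most [2^(3n) 3^n = 24^n] points are needed,
   and rounding costs [n * (57/32) N sx^2 / (16 n)], which leaves
   [1/8 - 57/512 = 7/512 >= 1/128]. *)
Lemma excess_lower_bound : exists E : set T,
  [/\ measurable E, (P (~` E) <= (2 * expR (- ell))%:E)%E &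
    forall w v, E w -> N * sx ^+ 2 / 128 * \sum_k v k ^+ 2 <= excess v w].
Proof.
have [n1 l1 hN1 hN21] := And4 n0 ell0 hN hN2.
have s2 : 0 < sx ^+ 2 by rewrite exprn_gt0.
pose B := (3 * #|K|)%N.
pose h : R := (2 * Num.sqrt n)^-1.
have sn : 0 < Num.sqrt n by rewrite sqrtr_gt0; lra.
have h0 : 0 < h by rewrite invr_gt0 mulr_gt0.
pose pt (z : grid K B) (k : K) : R := h * (grid_coord z k)%:~R.
have [E1 [mE1 PE1 E1P]] := @union_bound _ T R P (grid K B) (small_grid K B)
  (fun z => [set w | 0 < N * sx ^+ 2 / 8 * \sum_k pt z k ^+ 2 - excess (pt z) w])
  (expR (- (7 / 2 * n + ell)))
  (fun z _ => (excess_lower_tail (pt z)).1) (fun z _ => (excess_lower_tail (pt z)).2).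
have [E2 [mE2 PE2 E2P]] := @union_bound _ T R P K (finset.setTfor K)
  (fun k => [set w | 0 < excess (fun j => (j == k)%:R) w - 57 / 32 * N * sx ^+ 2])
  (expR (- (n / 2 + ell)))
  (fun k _ => (excess_upper_tail k).1) (fun k _ => (excess_upper_tail k).2).
exists (E1 `&` E2); split; first exact: measurableI.
  rewrite setCI; apply: le_trans (measureU2 _ _ _) _; try exact: measurableC.
  rewrite (_ : 2 * expR (- ell) = expR (- ell) + expR (- ell)); last by ring.
  rewrite EFinD; apply: leeD.
    apply: (le_trans PE1); rewrite lee_fin opprD expRD mulrA.
    rewrite ler_piMl ?expR_ge0// expRN ler_pdivrMr ?expR_gt0// mul1r.
    apply: (le_trans (card_small_grid R K B)).
    rewrite /B exprM -exprMn (mulrC (7 / 2)) expRM_natl lerXn2r// ?nnegrE ?expR_ge0//.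
    by apply: le_trans (expR_ge24 R); lra.
  apply: (le_trans PE2); rewrite lee_fin opprD expRD mulrA cardsT.
  by rewrite ler_piMl ?expR_ge0// expRN ler_pdivrMr ?expR_gt0// mul1r nat_le_expR_half.
move=> w v [w1 w2].
pose phi v := excess v w - N * sx ^+ 2 / 8 * \sum_k v k ^+ 2.
have qphi : coord_quadratic phi (57 / 32 * N * sx ^+ 2).
  move=> {}v i.
  exists (\sum_g (2 * design v g w * W (inl (g, i)) w - 2 * mean_design v g * mu g i)
    - N * sx ^+ 2 / 4 * v i).
  (* The diagonal coefficient of [phi], bounded on [E2] by the upper tail. *)
  exists (excess (fun j => (j == i)%:R) w - N * sx ^+ 2 / 8); split.
    have := E2P w w2 i; rewrite /= inE => /(_ isT) /negP; rewrite -leNgt.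
    have : 0 < N * sx ^+ 2 by rewrite mulr_gt0.
    by lra.
  move=> e; rewrite /phi shift_at_sqr.
  have dE g : design (shift_at v i e) g w = design v g w + e * W (inl (g, i)) w.
    exact: shift_at_sum.
  have mE g : mean_design (shift_at v i e) g = mean_design v g + e * mu g i.
    exact: shift_at_sum.
  have -> : excess (shift_at v i e) w = excess v w +
      e * (\sum_g (2 * design v g w * W (inl (g, i)) w - 2 * mean_design v g * mu g i))
      + e ^+ 2 * excess (fun j => (j == i)%:R) w.
    rewrite /excess -!sumrB !mulr_sumr -!big_split/=; apply: eq_bigr => g _.
    have dB : design (fun j => (j == i)%:R) g w = W (inl (g, i)) w.
      exact: sum_basis.
    have mB : mean_design (fun j => (j == i)%:R) g = mu g i by exact: sum_basis.
    by rewrite dE mE dB mB; ring.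
  by field.
(* Rounding is applied with [c = 2] and [rho = 1], as [4 n h^2 = 1]; homogeneity extends the bound
   to every [v]. *)
have unit_bound v' : \sum_k v' k ^+ 2 = 1 -> N * sx ^+ 2 / 128 <= excess v' w.
  move=> v1.
  have := @uniform_from_lattice R K B phi (57 / 32 * N * sx ^+ 2) h 1 2 v'.
  move=> /(_ _ h0 isT qphi _ erefl); rewrite v1 lexx => H.
  have : 0 <= phi v' + #|K|%:R * (57 / 32 * N * sx ^+ 2 * h ^+ 2 / 4).
    apply: H => //.
    - by rewrite !mulr_ge0// ltW.
    - rewrite /h exprVn exprMn sqr_sqrtr -/n; last lra.
      by field; lra.
    - move=> z zB; have := E1P w w1 z; rewrite /= zB => /(_ isT) /negP.
      by rewrite -leNgt subr_le0 /phi subr_ge0.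
  rewrite -/n (_ : n * _ = 57 / 512 * (N * sx ^+ 2)); last first.
    by rewrite /h exprVn exprMn sqr_sqrtr; [field; lra|lra].
  have : 0 < N * sx ^+ 2 by rewrite mulr_gt0.
  by rewrite /phi v1; lra.
set U := \sum_k _.
have U0 : 0 <= U by apply: sumr_ge0 => k _; exact: sqr_ge0.
have [U_eq0|U_neq0] := eqVneq U 0.
  have v0 := sumr_sqr_eq0 U_eq0.
  rewrite U_eq0 mulr0 /excess !big1 ?subrr// => g _.
    by rewrite /mean_design big1 ?expr0n// => k _; rewrite v0 mul0r.
  by rewrite /design big1 ?expr0n// => k _; rewrite v0 mul0r.
have Up : 0 < U by rewrite lt_neqAle eq_sym U_neq0.
have := unit_bound (fun k => (Num.sqrt U)^-1 * v k).
rewrite excessZ exprVn sqr_sqrtr// => H.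
rewrite -ler_pdivlMr// [leRHS]mulrC; apply: H.
under eq_bigr do rewrite exprMn exprVn sqr_sqrtr//.
by rewrite -mulr_sumr mulVf.
Qed.

End design_energy.

(** * Noise projected on the row space of the design *)

Section noise.
Context d (T : measurableType d) (R : realType) (P : probability T R).
Context (G L : finType) (n : nat) (W : (G * 'I_n) + (G * L) -> {RV P >-> R}).
Context (se : R).
Hypothesis indep : mutually_independent P W.
Hypothesis se0 : 0 < se.
Hypothesis neta : forall g k, is_normal (W (inr (g, k))) 0 se.

Let J : set ((G * 'I_n) + (G * L)) := range inl.
Local Notation sigma_design := (g_sigma_algebraType (cylinders W J)).

Section fixed_frame.
Context (p : nat -> T -> G -> R).
Hypothesis mp : forall k g,
  @measurable_fun _ _ sigma_design R setT (fun w => p k w g).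
Hypothesis op : forall w, orthonormal0 n (fun k => p k w).

Definition noise (u : L -> R) (g : G) (w : T) : R :=
  \sum_k u k * W (inr (g, k)) w.
Definition frame (c : 'I_n -> R) (g : G) (w : T) : R := \sum_i c i * p i w g.
(** The bilinear form [u^T eta P c], written as a quadratic function of the joint vector
    [v = (u, c)] so that rounding applies. It is affine in each coordinate of [v]. *)
Definition cross (v : L + 'I_n -> R) (w : T) : R :=
  \sum_g noise (v \o inl) g w * frame (v \o inr) g w.

Lemma measurable_frame c g :
  @measurable_fun _ _ sigma_design R setT (frame c g).
Proof.
by apply: (@measurable_sum _ sigma_design) => i; exact: measurable_funM.
Qed.

Lemma measurable_cross v : measurable_fun setT (cross v).
Proof.
apply: measurable_sum => g; apply: measurable_funM.
  by apply: measurable_sum => k; exact: measurable_funM.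
exact: (measurable_sigma_of (@measurable_frame _ g)).
Qed.

Lemma sum_sum_type (f : L + 'I_n -> R) :
  \sum_i f i = \sum_k f (inl k) + \sum_i f (inr i).
Proof. exact: big_sumType. Qed.

Lemma frame_le c w : \sum_g frame c g w ^+ 2 <= \sum_i c i ^+ 2.
Proof.
pose c' (k : nat) := if insub k is Some i then c i else 0.
have c'E (i : 'I_n) : c' i = c i by rewrite /c' valK.
have := dot_orthonormal0_le c' (op w).
rewrite /dot; under eq_bigr do rewrite -expr2.
under [X in _ <= X]eq_bigr do rewrite c'E.
apply: le_trans; rewrite le_eqVlt; apply/orP; left; apply/eqP.
by apply: eq_bigr => g _; congr (_ ^+ 2); apply: eq_bigr => i _; rewrite c'E.
Qed.

(** Given the design, [cross v] is a centered Gaussian of variance at most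
    [se^2 |u|^2 |c|^2 <= se^2 S^2 / 4], by AM-GM. *)
Lemma cross_tail (v : L + 'I_n -> R) (x : R) : 0 <= x ->
  let f w := cross v w - se * Num.sqrt (2 * x) / 2 * \sum_i v i ^+ 2 in
  measurable [set w | 0 < f w] /\
  (P [set w | (0 < f w)%R] <= (expR (- x))%:E)%E.
Proof.
move=> x0; rewrite /=; set S := \sum_i v i ^+ 2.
pose f w := cross v w - se * Num.sqrt (2 * x) / 2 * S.
change (measurable [set w | 0 < f w] /\
  (P [set w | (0 < f w)%R] <= (expR (- x))%:E)%E).
have S0 : 0 <= S by apply: sumr_ge0 => i _; exact: sqr_ge0.
have mf : measurable_fun setT f.
  by apply: measurable_funB => //; exact: measurable_cross.
have [S_eq0|S_neq0] := eqVneq S 0.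
  have v0 := sumr_sqr_eq0 S_eq0.
  have -> : [set w | 0 < f w] = set0.
    apply/seteqP; split=> w //=; rewrite /f S_eq0 mulr0 subr0 /cross big1 ?ltxx// => g _.
    by rewrite /noise big1 ?mul0r// => k _; rewrite /= v0 mul0r.
  by rewrite measure0; split => //; rewrite lee_fin expR_ge0.
have Sp : 0 < S by rewrite lt_neqAle eq_sym S_neq0.
have [x_eq0|x_neq0] := eqVneq x 0.
  have mA := measurable_gt0 mf.
  by split => //; rewrite x_eq0 oppr0 expR0; exact: probability_le1.
have xp : 0 < x by rewrite lt_neqAle eq_sym x_neq0.
have sq : 0 < Num.sqrt (2 * x) by rewrite sqrtr_gt0 mulr_gt0.
(* Threshold divided by the variance bound: the exponent becomes [-2x + x]. It is positive since
   [x = 0] was treated apart. *)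
pose lam := 2 * Num.sqrt (2 * x) / (se * S).
have lam0 : 0 < lam by rewrite divr_gt0 ?mulr_gt0.
have -> : [set w | 0 < f w] = [set w | 0 < lam * f w].
  by apply/seteqP; split=> w /=; rewrite pmulr_rgt0.
apply: expectation_bound; first exact: measurable_funM.
pose r : seq ((G * 'I_n) + (G * L)) := [seq inr q | q <- enum {: G * L}].
pose b (c : (G * 'I_n) + (G * L)) w :=
  match c with inl _ => 0 | inr q => lam * v (inl q.2) * frame (v \o inr) q.1 w end.
have sum_r (F : _ -> R) : \sum_(c <- r) F c = \sum_g \sum_k F (inr (g, k)).
  by rewrite big_map big_enum/= pair_bigA; apply: eq_bigr => -[].
under eq_integral => w _.
  rewrite (_ : lam * f w = - (2 * x) + \sum_(c <- r) b c w * W c w).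
    rewrite expRD; over.
  rewrite sum_r /f mulrBr addrC; congr (_ + _).
    rewrite -[in RHS](sqr_sqrtr (_ : 0 <= 2 * x)) ?mulr_ge0//.
    by rewrite /lam; field; rewrite !gt_eqF.
  rewrite /cross mulr_sumr; apply: eq_bigr => g _.
  rewrite /noise mulr_suml mulr_sumr; apply: eq_bigr => k _.
  by rewrite /b/=; ring.
rewrite (@expectation_linear_seq _ _ _ P _ W se indep (lt0r_neq0 se0) r J b
  (fun=> expR (- (2 * x))))//; last 4 first.
- by rewrite map_inj_uniq ?enum_uniq// => q q' [].
- by move=> c /mapP[q _ ->] [].
- by move=> c /mapP[[g k] _ ->]; exact: neta.
- move=> c /mapP[[g k] _ ->].
  by apply: measurable_funM => //; exact: measurable_frame.
apply: (@le_trans _ _ (\int[P]_w (expR (- x))%:E)%E); last first.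
  by rewrite integral_cst//= probability_setT mule1.
apply: ge0_le_integral => //.
- apply/measurable_EFinP; apply: measurable_funM => //.
  apply: measurableT_comp => //; apply: measurable_funM => //.
  apply: measurable_sum => c; apply: measurable_funX.
  case: c => [q|[g k]]; first exact: measurable_cst.
  apply: measurable_funM => //.
  exact: (measurable_sigma_of (@measurable_frame _ g)).
move=> w _; rewrite lee_fin -expRD ler_expR.
have H : \sum_(c <- r) b c w ^+ 2 <= lam ^+ 2 * (S ^+ 2 / 4).
  rewrite sum_r.
  pose V1 := \sum_k v (inl k) ^+ 2; pose V2 := \sum_i v (inr i) ^+ 2.
  have -> : \sum_g \sum_k b (inr (g, k)) w ^+ 2 =
      lam ^+ 2 * (V1 * \sum_g frame (v \o inr) g w ^+ 2).
    rewrite mulr_sumr mulr_sumr; apply: eq_bigr => g _.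
    rewrite mulr_suml mulr_sumr; apply: eq_bigr => k _.
    by rewrite /b/= !exprMn -mulrA.
  rewrite ler_wpM2l ?sqr_ge0//.
  have V10 : 0 <= V1 by apply: sumr_ge0 => i _; exact: sqr_ge0.
  apply: (@le_trans _ _ (V1 * V2)); first by rewrite ler_wpM2l// frame_le.
  by rewrite /S sum_sum_type -/V1 -/V2; have := sqr_ge0 (V1 - V2); lra.
have : se ^+ 2 / 2 * \sum_(c <- r) b c w ^+ 2 <= x; last by lra.
apply: (@le_trans _ _ (se ^+ 2 / 2 * (lam ^+ 2 * (S ^+ 2 / 4)))).
  by rewrite ler_wpM2l// divr_ge0 ?sqr_ge0.
rewrite le_eqVlt; apply/orP; left; apply/eqP.
rewrite /lam expr_div_n exprMn sqr_sqrtr ?mulr_ge0//.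
by field; rewrite !gt_eqF.
Qed.

Lemma cross_coord_quadratic (kap : R) w :
  coord_quadratic (fun v => kap / 2 * \sum_i v i ^+ 2 - cross v w) (kap / 2).
Proof.
move=> v [k|i]; eexists; exists (kap / 2); split=> // e; rewrite shift_at_sqr.
- have nE g : noise (shift_at v (inl k) e \o inl) g w =
      noise (v \o inl) g w + e * W (inr (g, k)) w by exact: shift_at_sum.
  have -> : cross (shift_at v (inl k) e) w =
      cross v w + e * \sum_g W (inr (g, k)) w * frame (v \o inr) g w.
    rewrite /cross mulr_sumr -big_split/=; apply: eq_bigr => g _.
    by rewrite nE; rewrite mulrDl mulrA.
  set A := \sum_i _; set B := cross _ _; set C := \sum_g _.
  rewrite (_ : _ - (B + e * C) =
    kap / 2 * A - B + (kap * v (inl k) - C) * e + kap / 2 * e ^+ 2) //.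
  by field.
- have nE g : frame (shift_at v (inr i) e \o inr) g w =
      frame (v \o inr) g w + e * p i w g by exact: shift_at_sum.
  have -> : cross (shift_at v (inr i) e) w =
      cross v w + e * \sum_g noise (v \o inl) g w * p i w g.
    rewrite /cross mulr_sumr -big_split/=; apply: eq_bigr => g _.
    by rewrite nE mulrDr mulrCA.
  set A := \sum_i _; set B := cross _ _; set C := \sum_g _.
  rewrite (_ : _ - (B + e * C) =
    kap / 2 * A - B + (kap * v (inr i) - C) * e + kap / 2 * e ^+ 2) //.
  by field.
Qed.

(* Lattice step [sqrt (2 / s)] with [s = #|L| + n]: at most [2^(2s) 3^s = 12^s]
   points are needed. *)
Lemma cross_bound (ell : R) : 0 <= ell -> (0 < #|L| + n)%N ->
  let x := 64 / 25 * (#|L| + n)%:R + ell in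
  exists E : set T, [/\ measurable E, (P (~` E) <= (expR (- ell))%:E)%E &
    forall w v, E w -> \sum_i v i ^+ 2 <= 2 ->
      cross v w <= 5 / 4 * (se * Num.sqrt (2 * x))].
Proof.
move=> l0 s0 x; set kap := se * _.
have cI : #|{: L + 'I_n}| = (#|L| + n)%N by rewrite card_sum card_ord.
set s := (#|L| + n)%N in s0 x kap cI *.
have sR : (0 : R) < s%:R by rewrite ltr0n.
have x0 : 0 <= x by rewrite addr_ge0// mulr_ge0// ltW.
pose B := (2 * #|{: L + 'I_n}|)%N.
pose h : R := Num.sqrt (2 / s%:R).
have h0 : 0 < h by rewrite sqrtr_gt0 divr_gt0.
have h2 : h ^+ 2 = 2 / s%:R by rewrite sqr_sqrtr// ltW// divr_gt0.
pose pt (z : grid (L + 'I_n)%type B) (i : L + 'I_n) : R := h * (grid_coord z i)%:~R.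
have [E [mE PE EP]] := @union_bound _ T R P _ (small_grid (L + 'I_n)%type B)
  (fun z => [set w | 0 < cross (pt z) w - kap / 2 * \sum_i pt z i ^+ 2])
  (expR (- x))
  (fun z _ => (cross_tail (pt z) x0).1) (fun z _ => (cross_tail (pt z) x0).2).
exists E; split => //.
  apply: (le_trans PE); rewrite lee_fin /x opprD expRD mulrA.
  rewrite ler_piMl ?expR_ge0// expRN ler_pdivrMr ?expR_gt0// mul1r.
  apply: (le_trans (card_small_grid R _ B)).
  rewrite /B cI exprM -exprMn (mulrC (64 / 25)) expRM_natl.
  by rewrite lerXn2r// ?nnegrE ?expR_ge0//; apply: le_trans (expR_ge12 R); lra.
move=> w v Ew v2.
have kap0 : 0 <= kap by rewrite mulr_ge0 ?sqrtr_ge0// ltW.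
pose phi v := kap / 2 * \sum_i v i ^+ 2 - cross v w.
have : 0 <= phi v + #|{: L + 'I_n}|%:R * (kap / 2 * h ^+ 2 / 4).
  apply: (@uniform_from_lattice R _ B phi (kap / 2) h 2 1 v) => //.
  - by rewrite divr_ge0.
  - exact: cross_coord_quadratic.
  - by rewrite cI h2 expr1n mul1r mulrC divfK// gt_eqF.
  - move=> z zB; have := EP w Ew z; rewrite /= zB => /(_ isT) /negP.
    by rewrite -leNgt subr_le0 /phi subr_ge0.
(* Rounding costs [kap / 4] on top of [kap / 2 * 2], whence the factor [5/4]. *)
rewrite cI h2 (_ : s%:R * _ = kap / 4); last by field; rewrite gt_eqF.
have : kap / 2 * \sum_i v i ^+ 2 <= kap / 2 * 2 by rewrite ler_wpM2l// divr_ge0.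
by rewrite /phi; lra.
Qed.

End fixed_frame.

(** Every [design W y] lies in the span of the frame, with coordinates of the same norm, so one
    event of [cross_bound] serves all [u] and [y]. *)
Lemma noise_bound (ell : R) : 0 <= ell -> (0 < #|L| + n)%N ->
  let x := 64 / 25 * (#|L| + n)%:R + ell in
  exists E : set T, [/\ measurable E, (P (~` E) <= (expR (- ell))%:E)%E &
    forall w u y, E w ->
      \sum_g noise u g w * design W y g w <=
      5 / 4 * (se * Num.sqrt (2 * x)) * Num.sqrt (\sum_k u k ^+ 2) *
        Num.sqrt (\sum_g design W y g w ^+ 2)].
Proof.
move=> l0 s0 x.
pose a (k : nat) (w : T) (g : G) : R :=
  if insub k is Some i then W (inl (g, i)) w else 0.
have ma k g : @measurable_fun _ _ sigma_design R setT (fun w => a k w g).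
  rewrite /a; case: insubP => [i _ _|_]; last exact: measurable_cst.
  by apply: measurable_sigma_of_coord; exists (g, i).
have [p [mp op pa]] := @measurable_gram_schmidt R G _ sigma_design n a ma.
have [E [mE PE EP]] := cross_bound mp op l0 s0.
exists E; split => // w u y Ew.
set bet := 5 / 4 * _.
have bet0 : 0 <= bet by rewrite !mulr_ge0 ?sqrtr_ge0// ltW.
have [c [cE c2]] : exists c : nat -> R,
    (forall g, design W y g w = \sum_(i < n) c i * p i w g) /\
    \sum_(i < n) c i ^+ 2 = \sum_g design W y g w ^+ 2.
  have spanX : in_span n (fun k => p k w) (fun g => design W y g w).
    have -> : (fun g => design W y g w) = (fun g => \sum_(k < n) y k * a k w g).
      apply/funext => g; apply: eq_bigr => k _.
      by rewrite /a valK.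
    apply: (@in_span_sum R G n (fun k => p k w) 'I_n y (fun k => a k w)) => k.
    by apply: pa.
  have [c [cE c2]] := in_span_isometric (op w) spanX.
  exists c; split => //; rewrite c2 /dot.
set U := \sum_k u k ^+ 2; set D := \sum_g _ ^+ 2.
have U0 : 0 <= U by apply: sumr_ge0 => i _; exact: sqr_ge0.
have D0 : 0 <= D by apply: sumr_ge0 => i _; exact: sqr_ge0.
have rhs0 : 0 <= bet * Num.sqrt U * Num.sqrt D.
  by apply: mulr_ge0; [apply: mulr_ge0|]; rewrite ?sqrtr_ge0.
have [U_eq0|U_neq0] := eqVneq U 0.
  rewrite big1// => g _.
  by rewrite /noise big1 ?mul0r// => k _; rewrite (sumr_sqr_eq0 U_eq0) mul0r.
have [D_eq0|D_neq0] := eqVneq D 0.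
  rewrite big1// => g _.
  by rewrite (sumr_sqr_eq0 D_eq0) mulr0.
have sU : 0 < Num.sqrt U by rewrite sqrtr_gt0 lt_neqAle eq_sym U_neq0.
have sD : 0 < Num.sqrt D by rewrite sqrtr_gt0 lt_neqAle eq_sym D_neq0.
(* Each half is normalized separately, so that the joint vector has squared norm 2. *)
pose v (i : L + 'I_n) : R := match i with
  | inl k => (Num.sqrt U)^-1 * u k | inr i => (Num.sqrt D)^-1 * c i end.
have v2 : \sum_i v i ^+ 2 <= 2.
  rewrite sum_sum_type /v.
  under eq_bigr do rewrite exprMn exprVn sqr_sqrtr//.
  under [X in _ + X]eq_bigr do rewrite exprMn exprVn sqr_sqrtr//.
  by rewrite -!mulr_sumr c2 mulVf// mulVf//; lra.
have := EP w v Ew v2; rewrite -/bet.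
have -> : cross p v w = (Num.sqrt U)^-1 * (Num.sqrt D)^-1 *
    \sum_g noise u g w * design W y g w.
  rewrite /cross mulr_sumr; apply: eq_bigr => g _.
  rewrite cE /noise /frame.
  have -> : \sum_k (v \o inl) k * W (inr (g, k)) w =
      (Num.sqrt U)^-1 * \sum_k u k * W (inr (g, k)) w.
    by rewrite mulr_sumr; apply: eq_bigr => k _; rewrite mulrA.
  have -> : \sum_i (v \o inr) i * p i w g = (Num.sqrt D)^-1 * \sum_(i < n) c i * p i w g.
    by rewrite mulr_sumr; apply: eq_bigr => k _; rewrite mulrA.
  by rewrite mulrACA.
by rewrite -invfM mulrC ler_pdivrMr ?mulr_gt0// mulrA.
Qed.

End noise.

(** * The error rate *)

(** Holds as [e <= 4 <= 9/2]. The extra 1 makes [s ln (9 / delta)] dominate the dimension as well as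
    the confidence term. *)
Lemma ln_9_ge (R : realType) (delta : R) : 0 < delta ->
  ln (2 / delta) + 1 <= ln (9 / delta).
Proof.
move=> delta0; rewrite (_ : 9 / delta = 2 / delta * (9 / 2)); last first.
  by field; rewrite gt_eqF.
rewrite [ln (2 / delta * _)]lnM ?posrE ?divr_gt0// lerD2l -[leLHS]expRK ler_ln ?posrE ?expR_gt0//.
have H : 1 / 2 <= expR (- (1 / 2) : R).
  by apply: le_trans (expR_ge1Dx _); lra.
rewrite expRN in H.
have H2 : expR (1 / 2 : R) <= 2.
  by rewrite -[leLHS]invrK -[leRHS]invrK lef_pV2 ?posrE ?invr_gt0 ?expR_gt0//; lra.
rewrite (_ : 1 = 2%:R * (1 / 2) :> R); last by lra.
rewrite expRM_natl; apply: (@le_trans _ _ (2 ^+ 2)); last by lra.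
by rewrite lerXn2r// nnegrE ?expR_ge0.
Qed.

(* After squaring, this is [(sx^2 + 4 rho)^2 <= 16 (8 sx^2 + rho) (sx^2 / 128 + rho)]
   with [rho = sx^2 (lam0 - 1) / 4], so that [sx^2 lam0 = sx^2 + 4 rho]. *)
Lemma error_rate_le (R : realType) (sx se N lam0 mu s ell lnq : R) :
  0 < sx -> 0 < se -> 0 < N -> 1 <= lam0 -> 0 <= mu ->
  sx ^+ 2 * (lam0 - 1) / 4 <= mu ^+ 2 -> 2 <= s -> 0 < ell -> ell + 1 <= lnq ->
  5 / 4 * (se * Num.sqrt (2 * (64 / 25 * s + ell))) /
    Num.sqrt (N * (sx ^+ 2 / 128 + sx ^+ 2 * (lam0 - 1) / 4)) <=
  8 * se * (4 * sx * Num.sqrt (s * lnq)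
    + mu * (Num.sqrt (2 * s) + 2 * Num.sqrt ell)) /
    (Num.sqrt N * sx ^+ 2 * lam0).
Proof.
move=> sx0 se0 N0 lam1 mu0 rhomu s2 ell0 lnq1.
set rho := sx ^+ 2 * (lam0 - 1) / 4.
pose D := Num.sqrt (2 * s + 4 * ell).
have rho0 : 0 <= rho by rewrite /rho divr_ge0// mulr_ge0 ?sqr_ge0// subr_ge0.
have s20 : 0 < sx ^+ 2 by rewrite exprn_gt0.
have D2 : D ^+ 2 = 2 * s + 4 * ell by rewrite sqr_sqrtr//; lra.
have D0 : 0 < D by rewrite sqrtr_gt0; lra.
have sqN : 0 < Num.sqrt N by rewrite sqrtr_gt0.
have le_of_sqr (a b : R) : 0 <= b -> a ^+ 2 <= b ^+ 2 -> a <= b.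
  move=> b0 ab; have [a0|a0] := leP a 0; first exact: le_trans b0.
  by rewrite -(ler_pXn2r (_ : 0 < 2)%N)// nnegrE ltW.
(* After squaring, [25/16 * 2 * 64/25 = 8] matches the coefficient of [s] exactly. *)
have H1 : 5 / 4 * (se * Num.sqrt (2 * (64 / 25 * s + ell))) <= 2 * se * D.
  apply: le_of_sqr; first by rewrite !mulr_ge0// ltW.
  rewrite !exprMn D2 sqr_sqrtr; last by lra.
  have : 0 <= se ^+ 2 * ell by rewrite mulr_ge0 ?sqr_ge0// ltW.
  by lra.
have H2 : D <= Num.sqrt (2 * s) + 2 * Num.sqrt ell.
  apply: le_of_sqr; first by rewrite addr_ge0 ?mulr_ge0 ?sqrtr_ge0.
  rewrite sqrrD exprMn D2 !sqr_sqrtr ?(ltW ell0)//; last by lra.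
  have : 0 <= Num.sqrt (2 * s) * (2 * Num.sqrt ell) by rewrite !mulr_ge0 ?sqrtr_ge0.
  by lra.
(* After squaring: [16 s + 32 ell <= 16 s (ell + 1)], because [s >= 2]. *)
have H3 : Num.sqrt 8 * D <= 4 * Num.sqrt (s * lnq).
  apply: le_of_sqr; first by rewrite mulr_ge0 ?sqrtr_ge0.
  have slnq : s * (ell + 1) <= s * lnq by rewrite ler_wpM2l//; lra.
  have : 0 <= (s - 2) * ell by rewrite mulr_ge0//; lra.
  have sl0 : 0 <= s * lnq by rewrite mulr_ge0//; lra.
  by rewrite !exprMn D2 !sqr_sqrtr//; move: slnq; lra.
pose Q := Num.sqrt (sx ^+ 2 / 128 + rho).
have Q2 : Q ^+ 2 = sx ^+ 2 / 128 + rho by rewrite sqr_sqrtr//; lra.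
have Q0 : 0 < Q by rewrite sqrtr_gt0; lra.
have q8 : 0 <= Num.sqrt 8 :> R by exact: sqrtr_ge0.
have H4 : sx ^+ 2 + 4 * rho <= 4 * (Num.sqrt 8 * sx + mu) * Q.
  apply: le_of_sqr.
    by rewrite !mulr_ge0 ?(ltW Q0)// addr_ge0// mulr_ge0// ltW.
  rewrite !exprMn Q2.
  have : 8 * sx ^+ 2 + rho <= (Num.sqrt 8 * sx + mu) ^+ 2.
    rewrite sqrrD exprMn sqr_sqrtr//.
    have : 0 <= Num.sqrt 8 * sx * mu by rewrite !mulr_ge0// ltW.
    by move: rhomu; rewrite -/rho; lra.
  move=> /(ler_wpM2r (_ : 0 <= 16 * (sx ^+ 2 / 128 + rho))) H.
  have : (8 * sx ^+ 2 + rho) * (16 * (sx ^+ 2 / 128 + rho)) <=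
      (Num.sqrt 8 * sx + mu) ^+ 2 * (16 * (sx ^+ 2 / 128 + rho)) by apply: H; lra.
  have : 0 <= sx ^+ 2 * rho by rewrite mulr_ge0// ltW.
  by lra.
have lamE : sx ^+ 2 * lam0 = sx ^+ 2 + 4 * rho by rewrite /rho; field.
rewrite [Num.sqrt (N * _)]sqrtrM ?(ltW N0)// -/Q -(mulrA (Num.sqrt N)) lamE.
rewrite ler_pdivrMr ?mulr_gt0// [leRHS]mulrAC ler_pdivlMr; last first.
  by rewrite mulr_gt0//; lra.
apply: (@le_trans _ _ (2 * se * D * (Num.sqrt N * (4 * (Num.sqrt 8 * sx + mu) * Q)))).
  rewrite ler_pM//.
  - by rewrite !mulr_ge0 ?sqrtr_ge0// ltW.
  - by rewrite mulr_ge0 ?sqrtr_ge0//; lra.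
  - by rewrite ler_wpM2l ?sqrtr_ge0.
rewrite (_ : 2 * se * D * _ =
  8 * se * (Num.sqrt 8 * D * sx + mu * D) * (Num.sqrt N * Q)); last by ring.
rewrite ler_wpM2r ?mulr_ge0 ?sqrtr_ge0// ler_wpM2l ?mulr_ge0 ?(ltW se0)//.
apply: lerD; last by rewrite ler_wpM2l.
by rewrite [leRHS]mulrAC ler_wpM2r// ltW.
Qed.

Theorem theorem2
  (R : realType) (d : measure_display) (T : measurableType d)
  (P : probability T R)
  (m n l : nat) (hm : (0 < m)%N) (hn : (0 < n)%N) (hl : (0 < l)%N)
  (Theta : 'M[R]_(l, n))
  (sx se : R) (hsx : 0 < sx) (hse : 0 < se)
  (mu : 'I_m -> nat -> 'cV[R]_n)
  (hmu_bdd : has_ubound (range (fun p : 'I_m * nat => enorm (mu p.1 p.2))))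
  (x : 'I_m -> nat -> 'I_n -> {RV P >-> R})
  (eta : 'I_m -> nat -> 'I_l -> {RV P >-> R})
  (hx : forall i j k, is_normal (x i j k) (mu i j k 0) sx)
  (heta : forall i j k, is_normal (eta i j k) 0 se)
  (hindep : mutually_independent P
     (fun c : ('I_m * nat * 'I_n) + ('I_m * nat * 'I_l) =>
        match c with
        | inl (i, j, k) => x i j k
        | inr (i, j, k) => eta i j k
        end))
  (delta : R) (hdelta : 0 < delta) (t : nat) :
  let muhat := sup (range (fun p : 'I_m * nat => enorm (mu p.1 p.2))) in
  let t1 := 8 * n%:R + 16 * ln (2 / delta) in
  let t2 := (16 * muhat * (Num.sqrt (4 * n%:R) + Num.sqrt (2 * ln (2 / delta)))
             / sx) ^+ 2 in
  let t3 := 2 * (n + l)%:R * ln (1 / delta) in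
  (m%:R)^-1 * Num.max t1 (Num.max t2 t3) <= t%:R ->
  (* x_{i,j} and y_{i,j} (time j+1 is indexed by j : nat, j < t) *)
  let X (i : 'I_m) (j : nat) (w : T) : 'cV[R]_n := \col_k x i j k w in
  let Y (i : 'I_m) (j : nat) (w : T) : 'cV[R]_l :=
    Theta *m X i j w + \col_k eta i j k w in
  let Thetahat (w : T) : 'M[R]_(l, n) :=
    (\sum_(i < m) \sum_(j < t) Y i j w *m (X i j w)^T) *m
    invmx (\sum_(i < m) \sum_(j < t) X i j w *m (X i j w)^T) in
  let mubar : 'M[R]_n :=
    (4 / (m%:R * t%:R * sx ^+ 2)) *: \sum_(i < m) \sum_(j < t) mu i j *m (mu i j)^T in
  let C1 := 8 * se * (4 * sx * Num.sqrt ((n + l)%:R * ln (9 / delta))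
             + muhat * (Num.sqrt (2 * (l + n)%:R) + 2 * Num.sqrt (ln (2 / delta)))) in
  exists E : set T, measurable E /\
    E `<=` [set w | opnorm (Thetahat w - Theta)
                    <= C1 / (Num.sqrt (m%:R * t%:R) * sx ^+ 2 * lambda_min (1%:M + mubar))] /\
    ((1 - 4 * delta)%:E <= P E)%E.
Proof.
move=> muhat t1 t2 t3 ht X Y Thetahat mubar C1.
(* For [delta >= 1/4] the required probability is at most 0; below that, [2 / delta > 1] makes [ell]
   positive. *)
have [d4|d4] := leP (1 / 4) delta.
  exists set0; split; first exact: measurable0.
  split; first by move=> w.
  by rewrite measure0 lee_fin; lra.
pose ell := ln (2 / delta).
have del2 : 0 < delta / 2 by rewrite divr_gt0.
have d2 : 0 < 2 / delta by rewrite divr_gt0.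
have expell : expR (- ell) = delta / 2.
  by rewrite expRN lnK ?posrE// invf_div.
have ell0 : 0 < ell by rewrite ln_gt0// ltr_pdivlMr//; lra.
have mR : (0 : R) < m%:R by rewrite ltr0n.
have nR : (1 : R) <= n%:R by rewrite ler1n.
have lR : (1 : R) <= l%:R by rewrite ler1n.
pose N : R := m%:R * t%:R.
have hmax : Num.max t1 (Num.max t2 t3) <= N.
  by rewrite -(ler_pM2l (_ : 0 < m%:R^-1)) ?invr_gt0// /N mulKf ?gt_eqF.
have hN : 8 * n%:R + 16 * ell <= N.
  by apply: le_trans hmax; rewrite le_max lexx.
have N0 : 0 < N by apply: lt_le_trans hN; lra.
have muhat_ub i j : enorm (mu i j) <= muhat.
  by apply: ub_le_sup => //; exists (i, j).
have muhat0 : 0 <= muhat.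
  by apply: le_trans (muhat_ub (Ordinal hm) 0%N); exact: sqrtr_ge0.
have hN2 : 256 * muhat ^+ 2 * (4 * n%:R + 2 * ell) <= N * sx ^+ 2.
  have : t2 <= N by apply: le_trans hmax; rewrite !le_max lexx orbT.
  rewrite /t2 expr_div_n ler_pdivrMr ?exprn_gt0// => H.
  apply: le_trans H; rewrite 2!exprMn -/ell; set q := Num.sqrt _ + _.
  have : 4 * n%:R + 2 * ell <= q ^+ 2.
    rewrite /q sqrrD !sqr_sqrtr ?mulr_ge0 ?(ltW ell0)//.
    have : 0 <= Num.sqrt (4 * n%:R) * Num.sqrt (2 * ell) :> R.
      by rewrite mulr_ge0 ?sqrtr_ge0.
    by clear; lra.
  by move=> /(ler_wpM2l (sqr_ge0 muhat)); clear; lra.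
pose G : finType := ('I_m * 'I_t)%type.
pose Z (c : ('I_m * nat * 'I_n) + ('I_m * nat * 'I_l)) : {RV P >-> R} :=
  match c with inl (i, j, k) => x i j k | inr (i, j, k) => eta i j k end.
(* Restricts the infinite family to the finitely many times before [t]. *)
pose f (c : (G * 'I_n) + (G * 'I_l)) : ('I_m * nat * 'I_n) + ('I_m * nat * 'I_l) :=
  match c with
  | inl (i, j, k) => inl (i, val j, k) | inr (i, j, k) => inr (i, val j, k)
  end.
pose W := Z \o f.
have finj : injective f.
  by move=> [[[i j] k]|[[i j] k]] [[[i' j'] k']|[[i' j'] k']] //= [-> /val_inj-> ->].
have indW : mutually_independent P W by exact: mutually_independent_comp finj hindep.
pose mug (g : G) (k : 'I_n) := mu g.1 g.2 k 0.
have nW g k : is_normal (W (inl (g, k))) (mug g k) sx.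
  by case: g => i j; exact: hx.
have nWe g k : is_normal (W (inr (g, k))) 0 se.
  by case: g => i j; exact: heta.
have hmug g : \sum_k mug g k ^+ 2 <= muhat ^+ 2.
  have := muhat_ub g.1 g.2; rewrite /enorm => H.
  rewrite -[leLHS]sqr_sqrtr; last by apply: sumr_ge0 => k _; exact: sqr_ge0.
  by rewrite lerXn2r// nnegrE ?sqrtr_ge0.
have cG : #|G|%:R = N by rewrite card_prod !card_ord natrM.
have [E1 [mE1 PE1 HE1]] := @excess_lower_bound _ T R P G 'I_n 'I_l W mug sx indW hsx
  nW muhat ell ell0 (ltac:(by rewrite card_ord)) hmug
  (ltac:(by rewrite card_ord cG)) (ltac:(by rewrite card_ord cG)).
have nl0 : (0 < #|'I_l| + n)%N by rewrite card_ord addn_gt0 hl.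
have [E2 [mE2 PE2 HE2]] := @noise_bound _ T R P G 'I_l n W se indW hse nWe ell
  (ltW ell0) nl0.
have mE : measurable (E1 `&` E2) by exact: measurableI.
exists (E1 `&` E2); split => //; split; last first.
  have PC : (P (~` (E1 `&` E2)) <= (3 * (delta / 2))%:E)%E.
    rewrite setCI; apply: le_trans (measureU2 _ _ _) _; try exact: measurableC.
    rewrite (_ : 3 * _ = 2 * (delta / 2) + delta / 2); last by ring.
    by rewrite EFinD -expell; exact: leeD.
  have Pfin : P (E1 `&` E2) \is a fin_num by exact: fin_num_measure.
  by move: PC; rewrite probability_setC// -(fineK Pfin) -EFinB !lee_fin;
    move: del2; clear; lra.
move=> w [/HE1 low /HE2 noi] /=.
pose Xg (g : G) : 'cV[R]_n := X g.1 g.2 w.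
pose Ng (g : G) : 'cV[R]_l := \col_k eta g.1 g.2 k w.
have sumG (V : zmodType) (F : 'I_m -> 'I_t -> V) :
    \sum_(i < m) \sum_(j < t) F i j = \sum_(g : G) F g.1 g.2.
  by rewrite pair_bigA.
have -> : Thetahat w = (\sum_g (Theta *m Xg g + Ng g) *m (Xg g)^T) *m
    invmx (\sum_g Xg g *m (Xg g)^T).
  by rewrite /Thetahat !sumG.
pose A : 'M[R]_n := 1%:M + mubar.
have sA : A^T = A.
  rewrite /A /mubar linearD/= trmx1; congr (_ + _); rewrite linearZ/=; congr (_ *: _).
  rewrite !sumG linear_sum/=; apply: eq_bigr => g _.
  by rewrite trmx_mul trmxK.
have NsX : 0 < N * sx ^+ 2 by rewrite mulr_gt0// exprn_gt0.
have AE (u : 'cV[R]_n) : bform A u u = sqnorm u +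
    4 / (N * sx ^+ 2) * \sum_g mean_design mug (fun k => u k 0) g ^+ 2.
  rewrite /bform /A mulmxDr mulmxDl mulmx1 mxE -sqnormE; congr (_ + _).
  rewrite /mubar sumG -scalemxAr -scalemxAl mxE; congr (_ * _).
  rewrite mulmx_sumr mulmx_suml summxE; apply: eq_bigr => g _.
  rewrite (mulmxA u^T) -(mulmxA (u^T *m _)) mxE big_ord1 expr2; congr (_ * _).
    by rewrite mulTmx_sum.
  by rewrite mulTmx_sum; apply: eq_bigr => k _; rewrite mulrC.
have A1 u : 1 * sqnorm u <= bform A u u.
  rewrite mul1r AE lerDl mulr_ge0 ?divr_ge0 ?(ltW NsX)//.
  by apply: sumr_ge0 => g _; exact: sqr_ge0.
have [lam1 ray] := lambda_min_rayleigh hn sA A1.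
set lam0 := lambda_min A in lam1 ray.
rewrite -/A -/lam0.
(* The Rayleigh bound is tested at a basis vector, where the means have energy at most
   [N muhat^2]. *)
have rho_le : sx ^+ 2 * (lam0 - 1) / 4 <= muhat ^+ 2.
  have e1 : sqnorm (delta_mx (Ordinal hn) 0 : 'cV[R]_n) = 1.
    rewrite /sqnorm (bigD1 (Ordinal hn))//= mxE !eqxx expr1n big1 ?addr0// => k k0.
    by rewrite mxE (negbTE k0) expr0n.
  pose u (k : 'I_n) : R := (delta_mx (Ordinal hn) 0 : 'cV[R]_n) k 0.
  have H : lam0 <= 1 + 4 / (N * sx ^+ 2) * \sum_g mean_design mug u g ^+ 2.
    by have := ray (delta_mx (Ordinal hn) 0); rewrite AE e1 mulr1.
  have := mean_design_le hmug u.
  have -> : \sum_k u k ^+ 2 = 1 by exact: e1.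
  rewrite cG mulr1; move: H; set S := \sum_g _ => H HS.
  have : 4 / (N * sx ^+ 2) * S <= 4 / (N * sx ^+ 2) * (N * muhat ^+ 2).
    by rewrite ler_wpM2l// divr_ge0// ltW.
  rewrite (_ : 4 / (N * sx ^+ 2) * (N * muhat ^+ 2) = 4 / sx ^+ 2 * muhat ^+ 2); last first.
    by field; rewrite !gt_eqF.
  move=> {}HS; have : lam0 - 1 <= 4 / sx ^+ 2 * muhat ^+ 2.
    by move: H HS; clear; lra.
  rewrite -(ler_pM2l (_ : 0 < sx ^+ 2 / 4)) ?divr_gt0 ?exprn_gt0//.
  rewrite (_ : sx ^+ 2 / 4 * (4 / sx ^+ 2 * muhat ^+ 2) = muhat ^+ 2); last first.
    by field; rewrite !gt_eqF.
  by rewrite mulrAC.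
(* The first term comes from [excess]; the second bounds [sum mu mu^T] from below, since [mubar] is
   that sum times [4 / (N sx^2)]. *)
pose Lam := N * (sx ^+ 2 / 128 + sx ^+ 2 * (lam0 - 1) / 4).
have Lam0 : 0 < Lam.
  rewrite mulr_gt0// ltr_pwDl ?divr_gt0 ?exprn_gt0//.
  by rewrite divr_ge0// mulr_ge0 ?sqr_ge0// subr_ge0.
have s2 : 2 <= (n + l)%:R :> R.
  by move: nR lR; rewrite natrD; clear; lra.
have lnq : ell + 1 <= ln (9 / delta) by exact: ln_9_ge.
have rate := error_rate_le hsx hse N0 lam1 muhat0 rho_le s2 ell0 lnq.
apply: (@le_trans _ _ (5 / 4 * (se * Num.sqrt (2 * (64 / 25 * (n + l)%:R + ell))) /
  Num.sqrt Lam)); last first.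
  by rewrite /C1 (addnC l n).
have beta0 : 0 <= 5 / 4 * (se * Num.sqrt (2 * (64 / 25 * (n + l)%:R + ell))).
  by rewrite !mulr_ge0 ?sqrtr_ge0// ltW.
apply: least_squares_error => //.
- move=> y.
  have EE : \sum_g (\sum_k Xg g k 0 * y k 0) ^+ 2 =
      \sum_g design W (fun k => y k 0) g w ^+ 2.
    apply: eq_bigr => g _; congr (_ ^+ 2); apply: eq_bigr => k _.
    by case: g => i j; rewrite mxE mulrC.
  rewrite EE.
  have := low (fun k => y k 0); rewrite cG /excess.
  have := ray y; rewrite AE -/(sqnorm y).
  set S := \sum_g mean_design _ _ _ ^+ 2; set D := \sum_g design _ _ _ _ ^+ 2.
  rewrite -(ler_pM2l (_ : 0 < N * sx ^+ 2 / 4)) ?divr_gt0// => H.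
  have : N * sx ^+ 2 / 4 * (sqnorm y + 4 / (N * sx ^+ 2) * S) =
    N * sx ^+ 2 / 4 * sqnorm y + S by field; rewrite !gt_eqF.
  by move: H; rewrite /Lam; clear; lra.
- move=> z y; have := noi (fun k => z k 0) (fun k => y k 0).
  rewrite card_ord (addnC l n) => H.
  have XE g : \sum_k Xg g k 0 * y k 0 = design W (fun k => y k 0) g w.
    by apply: eq_bigr => k _; case: g => i j; rewrite mxE mulrC.
  under eq_bigr do rewrite XE.
  under [X in _ <= _ * Num.sqrt X]eq_bigr do rewrite XE.
  apply: le_trans H; rewrite le_eqVlt; apply/orP; left; apply/eqP.
  apply: eq_bigr => g _; congr (_ * _); apply: eq_bigr => k _.
  by case: g => i j; rewrite mxE.
Qed.
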